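(* The set of all tilings of the plane by copies (obtained by rotation, reflection and translation) of the decorated hexagonal prototile that satisfy both matching rules (R1) and (R2) everywhere consists of exactly two local isomorphism classes.
   Context: The prototile. Take a regular hexagon (fixed side length) with vertices $v_0,\dots,v_5$ in counterclockwise order, indices mod 6. On each edge fix two points, symmetric about the edge's midpoint; a marking meeting the edge at one of them is said to meet it near the endpoint to which that point is closer. The prototile decoration consists of the following. Black stripes: a short curved stripe around $v_0$ joining edges $v_5v_0$ and $v_0v_1$ and meeting both near $v_0$; a short curved stripe around $v_3$ joining edges $v_2v_3$ and $v_3v_4$ and meeting both near $v_3$; and a long straight stripe joining the opposite edges $v_1v_2$ and $v_4v_5$, perpendicular to them and displaced from the center to one side: it meets them either near $v_1$ and $v_5$ (displaced toward $v_0$) or near $v_2$ and $v_4$ (displaced toward $v_3$). Colored diameters: diameter $v_1v_4$ is entirely red; diameter $v_2v_5$ is entirely blue; diameter $v_0v_3$ is the ''red–blue diameter'', one of its halves (from the center to a vertex) being red and the other blue. The colors stand for chirality of flags, so by convention every reflection interchanges red and blue. With this convention, the $12$ decorations of a hexagon obtained by choosing which of the three diameters plays the role of $v_0v_3$ (then, going counterclockwise by $60^\circ$ from it, the next diameter is red and the following one is blue), which of the two displacements the long stripe has, and which half of the red–blue diameter is red, are exactly the $12$ images of one single prototile under the six rotations and six reflections of the hexagon. Tilings: a tiling is a covering of the plane with no overlap by copies of the prototile; the hexagons then necessarily form the standard edge-to-edge tiling by regular hexagons. Rule (R1): black stripes are continuous across every edge, i.e. the two tiles sharing an edge have their black stripes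 meeting that edge at the same point. Rule (R2): for every edge of the tiling with endpoints $p,q$, let $t_p$ (resp. $t_q$) be the tile that has $p$ (resp. $q$) as a vertex but does not contain the edge $pq$; the half-diameter of $t_p$ ending at $p$ and the half-diameter of $t_q$ ending at $q$ (both collinear with the edge) must have different colors. Local isomorphism: two tilings $T_1$ and $T_2$ are locally isomorphic if and only if, given any finite $r$ and any configuration of tiles in $T_1$ contained within a disk of radius $r$, the same configuration of tiles (up to translation, rotation and reflection, reflections interchanging red and blue) can be found somewhere in $T_2$, and vice versa. A local isomorphism class is an equivalence class of tilings under this relation. *)

(* Defs.v *)
From HB Require Import structures.
From mathcomp Require Import all_boot all_order all_algebra.
From mathcomp Require Import all_classical all_reals all_analysis.
From mathcomp Require Import ring.

Set Implicit Arguments.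
Unset Strict Implicit.
Unset Printing Implicit Defensive.
Import Order.TTheory GRing.Theory Num.Theory.
Import numFieldNormedType.Exports.
Local Open Scope classical_set_scope.
Local Open Scope ring_scope.

Section Plane.
Variable R : realType.

Definition plane : Type := (R * R)%type.

(* The canonical norm of R * R is the sup norm, hence the explicit Euclidean
   distance. *)
Definition dist (p q : plane) : R :=
  Num.sqrt ((p.1 - q.1) ^+ 2 + (p.2 - q.2) ^+ 2).

Definition disk (x : plane) (r : R) : set plane := [set p | dist p x <= r].

(* [conjp] and [mulp] are complex conjugation and multiplication under the
   identification (x, y) = x + iy. *)
Definition conjp (p : plane) : plane := (p.1, - p.2).

Definition mulp (p q : plane) : plane :=
  (p.1 * q.1 - p.2 * q.2, p.1 * q.2 + p.2 * q.1).

(* The isometry z |-> shift + turn z, or z |-> shift + turn (conjp z) when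
   [mirror] holds, with |turn| = 1. *)
Record motion := Motion {
  shift : plane;
  turn : plane;
  mirror : bool;
  turn_unit : turn.1 ^+ 2 + turn.2 ^+ 2 == 1
}.

Definition act (g : motion) (p : plane) : plane :=
  let q := mulp (turn g) (if mirror g then conjp p else p) in
  ((shift g).1 + q.1, (shift g).2 + q.2).

Definition comp_turn (g h : motion) : plane :=
  mulp (turn g) (if mirror g then conjp (turn h) else turn h).

Lemma comp_turn_unit (g h : motion) :
  (comp_turn g h).1 ^+ 2 + (comp_turn g h).2 ^+ 2 == 1.
Proof.
have /eqP hg := turn_unit g; have /eqP hh := turn_unit h; apply/eqP.
transitivity (((turn g).1 ^+ 2 + (turn g).2 ^+ 2) *
              ((turn h).1 ^+ 2 + (turn h).2 ^+ 2)); last by rewrite hg hh mulr1.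
by rewrite /comp_turn /mulp /conjp; case: (mirror g) => /=; ring.
Qed.

Definition comp (g h : motion) : motion :=
  @Motion (act g (shift h)) (comp_turn g h) (mirror g (+) mirror h)
          (comp_turn_unit g h).

Lemma act_comp (g h : motion) (p : plane) : act (comp g h) p = act g (act h p).
Proof.
rewrite /act /comp /comp_turn /mulp /conjp /=.
by case: (mirror g); case: (mirror h) => /=; congr (_, _); ring.
Qed.

End Plane.

Section Tiles.
Variable R : realType.

(* Vertices of the prototile: the regular hexagon of side 1 centered at the
   origin, counterclockwise, with indices in Z/6. *)
Definition proto_vertex (k : 'Z_6) : plane R :=
  let h := Num.sqrt 3 / 2 in
  nth (0, 0) [:: (1, 0); (1 / 2, h); (- (1 / 2), h);
                 (- 1, 0); (- (1 / 2), - h); (1 / 2, - h)] k.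

Definition proto_hexagon : set (plane R) :=
  [set p | exists a : 'Z_6 -> R,
     [/\ forall k, 0 <= a k, \sum_k a k = 1
       & p = \sum_k a k *: proto_vertex k]].

(* Entry k is the index of the vertex near which the black stripe crossing the
   edge v_k v_(k+1) meets it: short stripes around v_0 and v_3, and a long
   stripe from v_1 v_2 to v_4 v_5 displaced toward v_0. *)
Definition proto_near (k : 'Z_6) : 'Z_6 :=
  nth 0 [:: 0; 1%:R; 3%:R; 3%:R; 5%:R; 0] k.

(* Is the half-diameter from the center to v_k red (rather than blue)?
   v_1 v_4 is red, v_2 v_5 is blue, and the half of v_0 v_3 at v_0 is red. *)
Definition proto_red (k : 'Z_6) : bool :=
  nth false [:: true; true; false; false; true; false] k.

(* No nontrivial symmetry of the hexagon preserves the decoration, so a copy of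
   the prototile is identified with the motion that carries the prototile
   to it. *)
Definition tile : Type := motion R.

Definition body (t : tile) : set (plane R) := act t @` proto_hexagon.

Definition vertex (t : tile) (k : 'Z_6) : plane R := act t (proto_vertex k).

(* An edge is represented by its set of endpoints. *)
Definition edge (t : tile) (k : 'Z_6) : set (plane R) :=
  [set vertex t k; vertex t (k + 1)].

(* The two possible meeting points on an edge are placed at a quarter of its
   length from either endpoint. *)
Definition stripe_point (t : tile) (k : 'Z_6) : plane R :=
  let near := proto_near k in
  let far := if near == k then k + 1 else k in
  (3 / 4) *: vertex t near + (1 / 4) *: vertex t far.

(* Reflections interchange red and blue. *)
Definition red (t : tile) (k : 'Z_6) : bool := mirror t (+) proto_red k.

Definition tiling (T : set tile) : Prop :=
  (forall p, exists2 t, T t & body t p) /\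
  (forall t t', T t -> T t' -> t <> t' ->
     interior (body t) `&` interior (body t') = set0).

Definition R1 (T : set tile) : Prop :=
  forall t t' k k', T t -> T t' -> edge t k = edge t' k' ->
    stripe_point t k = stripe_point t' k'.

Definition has_edge (t : tile) (p q : plane R) : Prop :=
  exists k, edge t k = [set p; q].

(* [vertex tp i] is the endpoint p and [vertex tq j] the endpoint q of an edge
   of the tiling. *)
Definition R2 (T : set tile) : Prop :=
  forall t tp tq i j, T t -> T tp -> T tq ->
    let p := vertex tp i in let q := vertex tq j in
    has_edge t p q -> ~ has_edge tp p q -> ~ has_edge tq p q ->
    red tp i <> red tq j.

Definition legal : set (set tile) :=
  [set T | [/\ tiling T, R1 T & R2 T]].

(* [comp g t] is the image of the copy t under g; when g is a reflection, the
   colors of t are interchanged. *)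
Definition embeds (T1 T2 : set tile) : Prop :=
  forall (r : R) (x : plane R) (P : set tile),
    P `<=` T1 -> (forall t, P t -> body t `<=` disk x r) ->
    exists g : motion R, forall t, P t -> T2 (comp g t).

Definition locally_isomorphic (T1 T2 : set tile) : Prop :=
  embeds T1 T2 /\ embeds T2 T1.

Definition LI_class (T : set tile) : set (set tile) :=
  [set T' | tiling T' /\ locally_isomorphic T T'].

End Tiles.

(* Main.v *)
From HB Require Import structures.
Require Import Defs.
From mathcomp Require Import all_boot all_order all_algebra.
From mathcomp Require Import all_classical all_reals all_analysis.
From mathcomp Require Import zify ring lra.
Import Defs.

Set Implicit Arguments.
Unset Strict Implicit.
Unset Printing Implicit Defensive.
Import Order.TTheory GRing.Theory Num.Theory.
Import numFieldNormedType.Exports.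
Local Open Scope classical_set_scope.
Local Open Scope ring_scope.

(** The centers of a tiling are pairwise at distance at least sqrt 3 and every
    point is within distance 1 of one of them, which forces them to be a
    triangular lattice: two centers closer than 2 sqrt 2 are at distance exactly
    sqrt 3 ([center_distance], by looking at circles through both of them), so
    each center has its six neighbours ([neighbor_std]).  A tiling is therefore,
    up to a motion, a field of tiles: a map from the lattice to the 12
    decorations ([tiling_field]), and the two rules become the conditions
    [edge_ok] and [diam_ok] between sites at distances sqrt 3 and 3.

    The heart of the matter is that these conditions force a hierarchy.  Call a
    site a hub when the long stripe of each of its six neighbours points at it.
    A search over patches of 19 tiles shows that the hubs of a legal decoration
    form a coset c + 2L of the lattice L.  Every other site is the midpoint of
    two hubs and its tile is determined by the hubs around it: the stripe of
    either of the two hubs fixes its displacement, and the colour of a third hub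
    fixes its red half ([coarse_refines]).  Restricted to the hubs, the
    decoration is again legal ([coarse_legal]), so the argument repeats at scales
    2, 4, 8 and so on.  Conversely the decoration of a large disk is determined
    by a cluster of seven tiles at a coarse scale ([agree_tower]).

    Call a cluster exceptional when, at some vertex of its central tile, the
    three half-diameters that end there have the same colour.  Refinement neither
    creates nor destroys such a vertex ([child_checks]), so a legal decoration
    without exceptional vertex has none at any scale; its clusters then belong to
    a list of 336 clusters ([atlas]), each of which occurs at every scale in every
    legal decoration ([nonexc_occurs]).  Hence all unexceptional tilings are
    locally isomorphic ([nonexc_repetitive]).  An exceptional vertex remains
    exceptional at all scales, so the whole hierarchy is centered at it and the
    decoration is unique once one of the three tiles around that vertex is given
    ([exc_unique]): all exceptional tilings are
    congruent.  Finally both kinds exist, as limits of inflation around a tile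
    and around a vertex ([regular], [singular]), and they are told apart by the
    three tiles around an exceptional vertex. *)

(** * Decorations of the triangular lattice *)

(** The six vertex directions of a hexagon, [Hk] standing for the angle 60k
    degrees.  The same letters index the six edges, [Hk] being the edge from
    vertex [Hk] to vertex [H(k+1)], and the six neighbouring sites across them. *)
Inductive dir := H0 | H1 | H2 | H3 | H4 | H5.

Definition dir_nat (i : dir) : nat :=
  match i with H0 => 0 | H1 => 1 | H2 => 2 | H3 => 3 | H4 => 4 | H5 => 5 end.
Definition nat_dir (n : nat) : dir :=
  match n with 0 => H0 | 1 => H1 | 2 => H2 | 3 => H3 | 4 => H4 | _ => H5 end%N.
Lemma dir_natK : cancel dir_nat nat_dir. Proof. by case. Qed.
HB.instance Definition _ := Equality.copy dir (can_type dir_natK).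

Definition dirs := [:: H0; H1; H2; H3; H4; H5].
Lemma mem_dirs i : i \in dirs. Proof. by case: i. Qed.

Definition nx (i : dir) : dir :=
  match i with H0 => H1 | H1 => H2 | H2 => H3 | H3 => H4 | H4 => H5 | H5 => H0 end.
Definition pv (i : dir) : dir :=
  match i with H0 => H5 | H1 => H0 | H2 => H1 | H3 => H2 | H4 => H3 | H5 => H4 end.
Definition opp (i : dir) : dir :=
  match i with H0 => H3 | H1 => H4 | H2 => H5 | H3 => H0 | H4 => H1 | H5 => H2 end.
Definition addd (i j : dir) : dir := iter (dir_nat i) nx j.
Definition subd (i j : dir) : dir := iter (dir_nat j) pv i.

(** The copy of the prototile turned by [k], and first reflected in the
    horizontal axis when [m] holds, is coded by [(k, m)]. *)
Definition deco := (dir * bool)%type.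
Definition decos : seq deco := [seq (i, m) | i <- dirs, m <- [:: false; true]].
Lemma mem_decos D : D \in decos. Proof. by case: D => [[] []]. Qed.

(** The prototile index of the vertex of the copy that lies in direction [i]. *)
Definition pidx (D : deco) (i : dir) : dir :=
  if D.2 then subd D.1 i else subd i D.1.

Definition first_end0 (i : dir) : bool :=
  match i with H0 | H1 | H3 => true | _ => false end.
(** Whether the stripe crossing edge [i] does so near vertex [i], rather than
    near the next one.  A reflection exchanges the two ends of an edge. *)
Definition first_end (D : deco) (i : dir) : bool :=
  if D.2 then ~~ first_end0 (pidx D (nx i)) else first_end0 (pidx D i).
Definition red0 (i : dir) : bool :=
  match i with H0 | H1 | H4 => true | _ => false end.
Definition red_deco (D : deco) (i : dir) : bool := D.2 (+) red0 (pidx D i).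

(** The long stripe crosses the edges [i] and [opp i]: going straight, it meets
    them on the same side, that is at opposite ends when both edges are read
    counterclockwise.  Two opposite edges crossed by short stripes are met at the same
    end. *)
Definition straight (D : deco) (i : dir) : bool := first_end D i == first_end D (opp i) (+) true.

(** Sites, in the basis formed by the neighbours across the edges [H0] and
    [H1], which make an angle of 60 degrees.  [dv i] is the neighbour across edge
    [i]; [wv i] is the nearest site in the direction of vertex [i], at sqrt 3
    times that distance. *)
Definition pos := (int * int)%type.
Definition dv (i : dir) : pos :=
  match i with
  | H0 => (1, 0) | H1 => (0, 1) | H2 => (-1, 1)
  | H3 => (-1, 0) | H4 => (0, -1) | H5 => (1, -1) end.
Definition wv (i : dir) : pos := dv (pv i) + dv i.

Lemma add1 (x y : pos) : (x + y).1 = x.1 + y.1. Proof. by []. Qed.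
Lemma add2 (x y : pos) : (x + y).2 = x.2 + y.2. Proof. by []. Qed.
Lemma opp1 (x : pos) : (- x).1 = - x.1. Proof. by []. Qed.
Lemma opp2 (x : pos) : (- x).2 = - x.2. Proof. by []. Qed.
Lemma posP (x y : pos) : x.1 = y.1 /\ x.2 = y.2 -> x = y.
Proof. by case: x y => [a b] [c d] /= [-> ->]. Qed.
Ltac plia := rewrite /wv; apply: posP; rewrite ?(add1, add2, opp1, opp2) /=; split; lia.

Lemma dv_opp i : dv (opp i) = - dv i. Proof. by case: i. Qed.
Lemma dv_nx i : dv i + dv (nx (nx i)) = dv (nx i). Proof. by case: i; plia. Qed.

(** Rule R1 across edge [i], and rule R2 for the two half-diameters that face
    each other along the edge starting at vertex [i].  The two tiles read their
    common edge in opposite senses, whence the inequality in [edge_ok]. *)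
Definition edge_ok (i : dir) (D D' : deco) := first_end D i != first_end D' (opp i).
Definition diam_ok (i : dir) (D D' : deco) := red_deco D i != red_deco D' (opp i).

Definition legal_deco (F : pos -> deco) : Prop :=
  forall y i, edge_ok i (F y) (F (y + dv i)) /\ diam_ok i (F y) (F (y + wv i)).

(** The decoration of a tile halfway, in direction [i], between a hub [X] and
    the next hub: its long stripe continues the stripe of [X], and its red half is
    dictated by the hub [a] that forms an equilateral triangle with both. *)
Definition mid_deco (i : dir) (X a : deco) : deco :=
  if first_end X i then (pv i, ~~ red_deco a (pv i)) else (opp (pv i), red_deco a (pv i)).

Lemma mid_decoE i X a D : straight D i -> edge_ok i X D -> diam_ok (opp (pv i)) D a -> D = mid_deco i X a.
Proof.
rewrite /mid_deco /edge_ok /diam_ok => + + +.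
have -> : opp (opp (pv i)) = pv i by case: i.
move: (red_deco a (pv i)) (first_end X i) => r n.
by case: i; case: r; case: n; case: D => [[] []].
Qed.

(** Rule R1 at the next scale: a long stripe transports the side on which an
    edge is crossed from one hub to the next. *)
Lemma edge_ok_through i D X Y : straight D i -> edge_ok i X D -> edge_ok i D Y -> edge_ok i X Y.
Proof.
rewrite /straight /edge_ok => /eqP ->; case: (first_end X i); case: (first_end D _); by case: (first_end Y _).
Qed.
(** Rule R2 at the next scale: the diameter perpendicular to the long stripe is
    the red-blue one, so passing through it restores the difference of colours
    that each of the two unit steps imposes. *)
Lemma diam_ok_through i D X Y : straight D (nx i) -> diam_ok i X D -> diam_ok i D Y -> diam_ok i X Y.
Proof.
rewrite /diam_ok; move: (red_deco X i) (red_deco Y _).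
by case: i; case: D => [[] []] // [] [].
Qed.

(** * Search over finite patches *)

(** How the rules constrain the tiles at [p] and [q]: [Some (true, i)] for R1
    across edge [i], [Some (false, i)] for R2 along vertex [i]. *)
Definition offset (p q : pos) : option (bool * dir) :=
  if [seq i <- dirs | q == p + dv i] is i :: _ then Some (true, i)
  else if [seq i <- dirs | q == p + wv i] is i :: _ then Some (false, i)
  else None.

Definition pair_ok (r : option (bool * dir)) (D D' : deco) : bool :=
  match r with
  | None => true
  | Some (true, i) => edge_ok i D D'
  | Some (false, i) => diam_ok i D D'
  end.

(** The constraints with the tiles already placed are computed once, before the
    partial patches are enumerated. *)
Definition extend (p : pos) (ps : seq pos) (sols : seq (seq deco)) :=
  let rs := [seq offset p q | q <- ps] in
  [seq D :: s | s <- sols, D <- [seq D <- decos | all2 (fun r => pair_ok r D) rs s]].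

Fixpoint extends (qs ps : seq pos) (sols : seq (seq deco)) :=
  if qs is q :: qs' then extend q (qs' ++ ps) (extends qs' ps sols) else sols.

Definition view (F : pos -> deco) (y : pos) (ps : seq pos) := [seq F (y + p) | p <- ps].

Lemma offset_ok F y p q : legal_deco F -> pair_ok (offset p q) (F (y + p)) (F (y + q)).
Proof.
move=> lF; rewrite /offset.
case E: [seq i <- dirs | q == p + dv i] => [|i s].
  case E': [seq i <- dirs | q == p + wv i] => [//|i s].
  have : i \in [seq i <- dirs | q == p + wv i] by rewrite E' inE eqxx.
  rewrite mem_filter => /andP [/eqP -> _] /=.
  by rewrite addrA; case: (lF (y + p) i).
have : i \in [seq i <- dirs | q == p + dv i] by rewrite E inE eqxx.
rewrite mem_filter => /andP [/eqP -> _] /=.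
by rewrite addrA; case: (lF (y + p) i).
Qed.

Lemma extends_view_at F y qs ps sols :
  {in qs ++ ps &, forall p q, pair_ok (offset p q) (F (y + p)) (F (y + q))} ->
  view F y ps \in sols -> view F y (qs ++ ps) \in extends qs ps sols.
Proof.
move=> ok h; elim: qs ok => //= q qs IH ok.
apply/allpairsPdep; exists (view F y (qs ++ ps)), (F (y + q)); split => //.
  by apply: IH => a b ha hb; apply: ok; rewrite inE ?ha ?hb orbT.
rewrite mem_filter mem_decos andbT /view.
have {IH} : {in qs ++ ps, forall p, pair_ok (offset q p) (F (y + q)) (F (y + p))}.
  by move=> a ha; apply: ok; rewrite inE ?eqxx // ha orbT.
elim: (qs ++ ps) => //= p s IH oks; rewrite oks ?inE ?eqxx //=.
by apply: IH => a ha; apply: oks; rewrite inE ha orbT.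
Qed.

Lemma extends_view F y qs ps sols : legal_deco F ->
  view F y ps \in sols -> view F y (qs ++ ps) \in extends qs ps sols.
Proof. by move=> lF; apply: extends_view_at => p q _ _; apply: offset_ok. Qed.

(** Lists of positions are extended at the head, so that the center comes last
    and is the first tile to be placed: this order keeps the enumeration small. *)
Definition ring1 : seq pos := [seq dv i | i <- rev dirs].
Definition ball1 : seq pos := ring1 ++ [:: 0].
Definition clusters : seq (seq deco) := extends ring1 [:: 0] [seq [:: D] | D <- decos].

Definition mkC (c : deco) (f : dir -> deco) : seq deco := [seq f i | i <- rev dirs] ++ [:: c].
Definition cluster (F : pos -> deco) (y : pos) := mkC (F y) (fun i => F (y + dv i)).

Lemma clusterE F y : cluster F y = view F y ball1.
Proof. by rewrite /cluster /mkC /view map_cat -map_comp /= addr0. Qed.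

Lemma cluster_legal F y : legal_deco F -> cluster F y \in clusters.
Proof.
move=> lF; rewrite clusterE; apply: extends_view => //.
by apply/mapP; exists (F y); rewrite ?mem_decos //= /view /= addr0.
Qed.

(** * Hubs and the coarse decoration *)

Definition hub (F : pos -> deco) (y : pos) : bool :=
  all (fun i => straight (F (y + dv i)) i) dirs.

Definition ring2 : seq pos := flatten [seq [:: dv i + dv i; wv i] | i <- rev dirs].
Definition ball2 := ring2 ++ ball1.
Definition hub_at (ps : seq pos) (p : pos) :=
  let ix := [seq (index (p + dv i) ps, i) | i <- dirs] in
  fun s : seq deco => all (fun ni => straight (nth (H0, false) s ni.1) ni.2) ix.

(** The hubs among the six neighbours: there is at least one, and they come in
    opposite pairs. *)
Definition hub_pattern :=
  let gs := [seq hub_at ball2 (dv i) | i <- dirs] in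
  fun s => let b := [seq g s | g <- gs] in
  has id b && (b == rot 3 b).

(** Only the patches of 19 tiles whose center is not a hub are needed; the
    constraint that it is not is imposed on the inner seven tiles at once. *)
Lemma hub_patches :
  all hub_pattern
    (extends ring2 ball1 [seq s <- clusters | ~~ hub_at ball1 0 s]).
Proof. vm_cast_no_check (erefl true). Qed.

Lemma straight_uniq D i j : straight D i -> straight D j -> j = i \/ j = opp i.
Proof. by case: D => [[] []]; case: i => // _; case: j => // _; auto. Qed.

Lemma hub_atE F y ps p : all (fun i => p + dv i \in ps) dirs ->
  hub_at ps p (view F y ps) = hub F (y + p).
Proof.
move=> /allP h; rewrite /hub_at /hub all_map; apply: eq_in_all => i /h hi /=.
rewrite (nth_map 0) ?index_mem // nth_index //.
by rewrite addrA.
Qed.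

(** Two adjacent hubs would impose different axes on their common neighbours. *)
Lemma hub_exclusive F y i : hub F y -> ~~ hub F (y + dv i).
Proof.
move=> /allP hy; apply/negP => /allP hi.
have := hy (nx i) (mem_dirs _); have := hi (nx (nx i)) (mem_dirs _).
rewrite -addrA dv_nx => h1 h2.
by case: (straight_uniq h1 h2); case: i {hi h1 h2}.
Qed.

Lemma hub_patch F m : legal_deco F -> ~~ hub F m ->
  (exists i, hub F (m + dv i)) /\
  (forall i, hub F (m + dv i) = hub F (m + dv (opp i))).
Proof.
move=> lF ng.
have in2 i : all (fun j => dv i + dv j \in ball2) dirs by case: i.
have /(allP hub_patches) : view F m ball2 \in
    extends ring2 ball1 [seq s <- clusters | ~~ hub_at ball1 0 s].
  apply: extends_view => //.
  rewrite mem_filter hub_atE // addr0 ng -clusterE; exact: cluster_legal.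
rewrite /hub_pattern -!map_comp => /andP [].
have -> : [seq ((fun g => g (view F m ball2)) \o (hub_at ball2 \o dv)) i | i <- dirs] =
    [seq hub F (m + dv i) | i <- dirs].
  by apply: eq_map => i /=; rewrite hub_atE.
rewrite has_map => /hasP [i _ hi] /eqP [e0 e1 e2 e3 e4 e5].
by split; [exists i | case].
Qed.

(** The tile halfway is not a hub, and the hubs around it come in pairs. *)
Lemma hub_step F y i : legal_deco F -> hub F y -> hub F (y + dv i + dv i).
Proof.
move=> lF gy; have [_ e] := hub_patch lF (hub_exclusive i gy).
by rewrite e dv_opp addrK.
Qed.

Definition aligned (F : pos -> deco) (c : pos) := forall z, hub F (c + (z + z)).

Lemma hub_aligned F c : legal_deco F -> hub F c -> aligned F c.
Proof.
move=> lF gc [a b].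
have step n y i : hub F y -> hub F (y + (dv i + dv i) *+ n).
  move=> gy; elim: n => [|n IH]; first by rewrite mulr0n addr0.
  rewrite mulrSr addrA; rewrite addrA; exact: hub_step.
have steps y (m : int) i : hub F y -> hub F (y + (dv i + dv i) *~ m).
  move=> gy; case: m => n; first exact: step.
  rewrite NegzE mulrNz -mulNrz opprD -!dv_opp; exact: step.
have := steps _ b H1 (steps _ a H0 gc); congr hub; rewrite -addrA; congr (_ + _).
have e (x : pos) (m : int) : x *~ m = (x.1 *~ m, x.2 *~ m).
  have en n : x *+ n = (x.1 *+ n, x.2 *+ n).
    by elim: n => [|n IH]; rewrite ?mulr0n // !mulrSr IH.
  by case: m => n; rewrite ?NegzE ?mulrNz -!pmulrn en.
rewrite !e !mulrzz; plia.
Qed.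

Lemma exists_aligned F : legal_deco F -> exists c, aligned F c.
Proof.
move=> lF; have [g|ng] := boolP (hub F 0); first by exists 0; apply: hub_aligned.
have [[i gi] _] := hub_patch lF ng; exists (0 + dv i); exact: hub_aligned.
Qed.

Lemma aligned_shift F c x : aligned F c -> aligned F (c + (x + x)).
Proof.
move=> h z; have := h (x + z); congr hub; plia.
Qed.

(** [F] is the decoration [G], enlarged twice and placed on the coset c + 2L,
    completed by the tiles halfway between its sites.  Since the six directions
    are allowed, each of these is described from both of its ends. *)
Definition refines (c : pos) (F G : pos -> deco) : Prop :=
  (forall z, F (c + (z + z)) = G z) /\
  (forall z i, F (c + (z + z) + dv i) = mid_deco i (G z) (G (z + dv (nx i)))).

Definition coarse (c : pos) (F : pos -> deco) (z : pos) : deco := F (c + (z + z)).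

Lemma aligned_straight F c z i : aligned F c -> straight (F (c + (z + z) + dv i)) i.
Proof. by move=> h; have /allP := h z; apply; exact: mem_dirs. Qed.

(** The tile halfway has its long stripe in direction [i] by definition of a hub,
    which leaves two displacements and two colourings; R1 with one hub selects the
    former and R2 with another one the latter. *)
Lemma coarse_refines F c : legal_deco F -> aligned F c -> refines c F (coarse c F).
Proof.
move=> lF al; split => // z i; apply: mid_decoE.
- exact: aligned_straight.
- by case: (lF (c + (z + z)) i).
have [_] := lF (c + (z + z) + dv i) (opp (pv i)).
by rewrite /coarse; congr (diam_ok _ _ (F _)); case: i; plia.
Qed.

Lemma coarse_legal F c : legal_deco F -> aligned F c -> legal_deco (coarse c F).
Proof.
move=> lF al z i; rewrite /coarse; split.
  have s := aligned_straight z i al; apply: (edge_ok_through s).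
    by case: (lF (c + (z + z)) i).
  have [+ _] := lF (c + (z + z) + dv i) i.
  by congr (edge_ok _ _ (F _)); plia.
have e : c + (z + z) + wv i = c + ((z + dv (pv i)) + (z + dv (pv i))) + dv (nx i).
  by case: i; plia.
have s : straight (F (c + (z + z) + wv i)) (nx i) by rewrite e; apply: aligned_straight.
apply: (diam_ok_through s); first by case: (lF (c + (z + z)) i).
have [_] := lF (c + (z + z) + wv i) i.
by congr (diam_ok _ _ (F _)); plia.
Qed.

Definition digit (u : option dir) : pos := if u is Some i then dv i else 0.

(** The four classes modulo 2L are represented by 0 and three of the six
    neighbours. *)
Lemma parent (y : pos) : exists z u,
  y = z + z + digit u /\ u \in [:: None; Some H0; Some H1; Some H2].
Proof.
pose z : pos := ((y.1 %/ 2)%Z, (y.2 %/ 2)%Z).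
have e : [\/ y = z + z, y = z + z + dv H0, y = z + z + dv H1 |
             y = (z + dv H0) + (z + dv H0) + dv H2].
  have [p|[p|[p|p]]] : (y.1 %% 2)%Z = 0 /\ (y.2 %% 2)%Z = 0 \/
    (y.1 %% 2)%Z = 1 /\ (y.2 %% 2)%Z = 0 \/
    (y.1 %% 2)%Z = 0 /\ (y.2 %% 2)%Z = 1 \/
    (y.1 %% 2)%Z = 1 /\ (y.2 %% 2)%Z = 1 by lia.
  - by apply: Or41; plia.
  - by apply: Or42; plia.
  - by apply: Or43; plia.
  by apply: Or44; plia.
case: e => e; [exists z, None | exists z, (Some H0) | exists z, (Some H1) |
  exists (z + dv H0), (Some H2)]; rewrite {1}e //= addr0 //.
Qed.

Definition proto_deco : deco := (H0, false).
(** Center and neighbours of a list of seven tiles, arranged as in [ball1]. *)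
Definition ctr (C : seq deco) := nth proto_deco C 6.
Definition arm (C : seq deco) (i : dir) := nth proto_deco C (5 - dir_nat i).
Lemma ctrE c f : ctr (mkC c f) = c. Proof. by []. Qed.
Lemma armE c f i : arm (mkC c f) i = f i. Proof. by case: i. Qed.

(** The cluster, in a refinement of a decoration, around the site at offset
    [digit u] from the double of the center of the cluster [C]. It only involves the
    seven tiles of [C]. *)
Definition child (u : option dir) (C : seq deco) : seq deco :=
  match u with
  | None => mkC (ctr C) (fun j => mid_deco j (ctr C) (arm C (nx j)))
  | Some i => mkC (mid_deco i (ctr C) (arm C (nx i)))
      (fun j => match subd j i with
        | H0 => arm C i
        | H1 => mid_deco (nx (nx i)) (arm C i) (ctr C)
        | H2 => mid_deco (nx i) (ctr C) (arm C (nx (nx i)))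
        | H3 => ctr C
        | H4 => mid_deco (pv i) (ctr C) (arm C i)
        | H5 => mid_deco (nx i) (arm C (pv i)) (ctr C)
        end)
  end.

Lemma eq_mkC c f g : f =1 g -> mkC c f = mkC c g.
Proof. by move=> e; rewrite /mkC; congr (_ ++ _); apply: eq_map. Qed.

(** Only the midpoints between the center and its neighbours, and between two
    consecutive neighbours, matter; this local form is used when it is not yet
    known that the fine decoration refines the coarse one everywhere. *)
Lemma cluster_child_local c F G z u :
  (forall x, F (c + (x + x)) = G x) ->
  (forall i, F (c + (z + z) + dv i) = mid_deco i (G z) (G (z + dv (nx i)))) ->
  (forall i, F (c + (z + dv i + (z + dv i)) + dv (nx (nx i))) =
     mid_deco (nx (nx i)) (G (z + dv i)) (G z)) ->
  cluster F (c + (z + z) + digit u) = child u (cluster G z).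
Proof.
move=> r0 r1 r2.
have fc x y : y = c + (x + x) -> F y = G x by move->.
have fm i y : y = c + (z + z) + dv i -> F y = mid_deco i (G z) (G (z + dv (nx i))).
  by move->.
have fn i y : y = c + (z + dv i + (z + dv i)) + dv (nx (nx i)) ->
    F y = mid_deco (nx (nx i)) (G (z + dv i)) (G z) by move->.
case: u => [i|]; rewrite /digit /child /cluster; last first.
  by rewrite addr0 r0 ctrE; apply: eq_mkC => i; rewrite r1 armE.
rewrite r1 ctrE armE; apply: eq_mkC => j; rewrite !armE.
have e4 : nx (pv i) = i by case: i.
have e5 : nx i = nx (nx (pv i)) by rewrite e4.
have fm4 y : y = c + (z + z) + dv (pv i) -> F y = mid_deco (pv i) (G z) (G (z + dv i)).
  by move/fm; rewrite e4.
have fn5 y : y = c + (z + dv (pv i) + (z + dv (pv i))) + dv (nx i) ->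
    F y = mid_deco (nx i) (G (z + dv (pv i))) (G z).
  by rewrite e5; apply: fn.
case E: (subd j i);
  [apply: fc | apply: fn | apply: fm | apply: fc | apply: fm4 | apply: fn5];
  by move: E; clear; case: i; case: j => //= _; plia.
Qed.

Lemma cluster_child c F G z u : refines c F G ->
  cluster F (c + (z + z) + digit u) = child u (cluster G z).
Proof.
move=> [r0 r1]; apply: cluster_child_local => // i.
by rewrite r1 -addrA; congr (mid_deco _ _ (G _)); case: i; plia.
Qed.

(** * Exceptional clusters and the atlas *)

(** Some vertex of the central tile has its three half-diameters of the same
    colour: vertex [i] of the center is vertex [i+4] of the neighbour across edge
    [i] and vertex [i+2] of the neighbour across the previous edge. *)
Definition exc (C : seq deco) : bool :=
  has (fun i => (red_deco (ctr C) i == red_deco (arm C i) (addd H4 i)) &&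
                (red_deco (ctr C) i == red_deco (arm C (pv i)) (addd H2 i))) dirs.
Definition nonexc (F : pos -> deco) := forall y, ~~ exc (cluster F y).

Definition legal_cluster (C : seq deco) : bool :=
  all (fun i => [&& edge_ok i (ctr C) (arm C i),
                    edge_ok (nx (nx i)) (arm C i) (arm C (nx i)) &
                    diam_ok (nx (nx i)) (arm C (pv i)) (arm C (nx i))]) dirs.

Definition digits : seq (option dir) := [:: None; Some H0; Some H1; Some H2].

Definition all_digits : seq (option dir) := None :: [seq Some i | i <- dirs].
Lemma mem_digits u : u \in all_digits. Proof. by case: u => [[]|]. Qed.

(** The cluster around a hub of hubs.  Its six neighbours are determined by its
    center, so that refining twice any cluster centered at [D] yields it. *)
Definition core (D : deco) : seq deco := child None (child None (mkC D (fun=> D))).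

Definition nexts (E : seq (seq deco)) : seq (seq deco) :=
  [seq child u C | C <- E, u <- digits].

(** Enumeration of the clusters of seven tiles that obey the rules: around a hub
    of hubs, the cluster is the core; refinement preserves the rules and creates
    no exceptional vertex; an exceptional vertex survives refinement. *)
Lemma child_checks : all (fun C => [&& child None (child None C) == core (ctr C),
   all (fun u => legal_cluster (child u C) && (exc (child u C) ==> exc C)) all_digits &
   exc C ==> has (fun u => exc (child u C)) all_digits]) clusters.
Proof. vm_cast_no_check (erefl true). Qed.

(** A synchronizing word: going down six levels from a tile in this particular
    way, one reaches a tile in the orientation of the prototile whatever the
    decoration at the start.  This is why a translation is enough to match patches
    of two unexceptional decorations. *)
Lemma core_sync D : child None (child None (child (Some H4) (child (Some H3) (core D)))) = core proto_deco.
Proof. by case: D => [[] []]; vm_compute. Qed.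

(** Breadth-first closure of a set of clusters under refinement. *)
Fixpoint grow (n : nat) (seen new : seq (seq deco)) : seq (seq deco) :=
  if n is n'.+1 then
    let fresh := undup [seq C <- nexts new | C \notin seen] in
    grow n' (fresh ++ seen) fresh
  else seen.

(** Six rounds exhaust the descendants of the core. *)
Definition atlas := grow 6 [:: core proto_deco] [:: core proto_deco].

Lemma atlas_checks : all (fun C => C \in atlas) (nexts [seq C <- clusters | ~~ exc C]).
Proof. vm_cast_no_check (erefl true). Qed.

Lemma atlasP C : C \in nexts [seq C <- clusters | ~~ exc C] -> C \in atlas.
Proof. exact: (allP atlas_checks C). Qed.

Lemma child_check C : C \in clusters ->
  [/\ child None (child None C) = core (ctr C),
     forall u, legal_cluster (child u C) /\ (exc (child u C) -> exc C) &
     exc C -> exists u, exc (child u C)].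
Proof.
move=> /(allP child_checks) /and3P [/eqP -> /allP h /implyP h']; split => //.
  by move=> u; have /h /andP [-> /implyP] := mem_digits u.
by move=> /h' /hasP [u _ eu]; exists u.
Qed.

Lemma coarsen F : legal_deco F -> exists c G, refines c F G /\ legal_deco G.
Proof.
move=> lF; have [c al] := exists_aligned lF.
by exists c, (coarse c F); split; [apply: coarse_refines | apply: coarse_legal].
Qed.

(** An exceptional vertex of the coarse decoration would give one of the fine
    decoration. *)
Lemma nonexc_coarse c F G : legal_deco G -> refines c F G -> nonexc F -> nonexc G.
Proof.
move=> lG r ne z; apply/negP => ez.
have [_ _ /(_ ez) [u eu]] := child_check (cluster_legal z lG).
by have := ne (c + (z + z) + digit u); rewrite (cluster_child _ _ r) eu.
Qed.

Definition occurs (C : seq deco) := forall F, legal_deco F -> exists y, cluster F y = C.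

(** Coarsen a given legal decoration, find the cluster there, and refine back. *)
Lemma occurs_child u C : occurs C -> occurs (child u C).
Proof.
move=> oC F lF; have [c [G [r lG]]] := coarsen lF; have [z e] := oC G lG.
by exists (c + (z + z) + digit u); rewrite (cluster_child _ _ r) e.
Qed.

Lemma occurs_core : occurs (core proto_deco).
Proof.
move=> F lF; have [c1 [G1 [r1 l1]]] := coarsen lF.
have [c2 [G2 [r2 l2]]] := coarsen l1; have [c3 [G3 [r3 l3]]] := coarsen l2.
have [c4 [G4 [r4 l4]]] := coarsen l3; have [c5 [G5 [r5 l5]]] := coarsen l4.
have [c6 [G6 [r6 l6]]] := coarsen l5.
have [e _ _] := child_check (cluster_legal 0 l6).
rewrite -(core_sync (ctr (cluster G6 0))) -e.
by eexists; rewrite -(cluster_child _ _ r6) -(cluster_child _ _ r5) -(cluster_child _ _ r4)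
  -(cluster_child _ _ r3) -(cluster_child _ _ r2) -(cluster_child _ _ r1).
Qed.

Lemma grow_ind (P : seq deco -> Prop) n seen new :
  (forall u C, P C -> P (child u C)) ->
  (forall C, C \in seen -> P C) -> (forall C, C \in new -> P C) ->
  forall C, C \in grow n seen new -> P C.
Proof.
move=> st; elim: n seen new => //= n IH seen new hs hn.
have hf C : C \in undup [seq C <- nexts new | C \notin seen] -> P C.
  rewrite mem_undup mem_filter => /andP [_ /allpairsP [[C' u] /= [h _ ->]]].
  by apply: st; apply: hn.
by apply: IH => // C; rewrite mem_cat => /orP [/hf|/hs].
Qed.

Lemma occurs_atlas C : C \in atlas -> occurs C.
Proof.
apply: grow_ind => {C} [u C|C|C]; first exact: occurs_child.
all: by rewrite inE => /eqP ->; exact: occurs_core.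
Qed.

(** The cluster is a descendant of an unexceptional cluster one level up, hence
    belongs to the atlas, all of whose members descend from the core. *)
Lemma nonexc_occurs F y : legal_deco F -> nonexc F -> occurs (cluster F y).
Proof.
move=> lF ne; have [c [G [r lG]]] := coarsen lF.
have [z [u [e du]]] := parent (y - c).
have -> : y = c + (z + z) + digit u by rewrite -addrA -e addrC subrK.
apply: occurs_atlas; rewrite (cluster_child _ _ r).
apply: atlasP; rewrite /nexts; apply: allpairs_f du.
rewrite mem_filter (nonexc_coarse lG r ne z); exact: cluster_legal.
Qed.

(** * Recurrence of unexceptional patches *)

Definition hex (r : int) (p : pos) : bool :=
  [&& - r <= p.1, p.1 <= r, - r <= p.2, p.2 <= r, - r <= p.1 + p.2 & p.1 + p.2 <= r].

Ltac hlia := rewrite /hex ?(add1, add2, opp1, opp2) /=; lia.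

Definition agree r (F F' : pos -> deco) (y y' : pos) :=
  forall d, hex r d -> F (y + d) = F' (y' + d).

Lemma cluster_inj F F' y y' : cluster F y = cluster F' y' ->
  F y = F' y' /\ forall i, F (y + dv i) = F' (y' + dv i).
Proof.
move=> e; split; first by have := congr1 ctr e.
by move=> i; have := congr1 (arm^~ i) e; rewrite /cluster !armE.
Qed.

Lemma agree_cluster F F' y y' : cluster F y = cluster F' y' -> agree 1 F F' y y'.
Proof.
move=> /cluster_inj [e0 e1] d hd.
suff [->|[i ->]] : d = 0 \/ exists i, d = dv i by rewrite ?addr0 ?e1.
have [e|[e|[e|[e|[e|[e|e]]]]]] : (d.1 = 0 /\ d.2 = 0) \/ (d.1 = 1 /\ d.2 = 0) \/
  (d.1 = 0 /\ d.2 = 1) \/ (d.1 = -1 /\ d.2 = 1) \/ (d.1 = -1 /\ d.2 = 0) \/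
  (d.1 = 0 /\ d.2 = -1) \/ (d.1 = 1 /\ d.2 = -1) by move: hd; hlia.
- by left; plia.
- by right; exists H0; plia.
- by right; exists H1; plia.
- by right; exists H2; plia.
- by right; exists H3; plia.
- by right; exists H4; plia.
by right; exists H5; plia.
Qed.

(** Agreement on a ball doubles its radius under refinement.  A tile halfway can
    be computed from either of its ends and from the hub on the corresponding
    side; for one of the two choices, both hubs lie in the smaller ball. *)
Lemma agree_refines r c c' F F' G G' z z' : 1 <= r ->
  refines c F G -> refines c' F' G' -> agree r G G' z z' ->
  agree (2 * r) F F' (c + (z + z)) (c' + (z' + z')).
Proof.
move=> r1 [g0 g1] [g0' g1'] ag d hd.
have fm x i : hex r x -> hex r (x + dv (nx i)) -> d = x + x + dv i ->
    F (c + (z + z) + d) = F' (c' + (z' + z') + d).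
  move=> h1 h2 ->.
  have -> : c + (z + z) + (x + x + dv i) = c + ((z + x) + (z + x)) + dv i by plia.
  have -> : c' + (z' + z') + (x + x + dv i) = c' + ((z' + x) + (z' + x)) + dv i by plia.
  by rewrite g1 g1' -!addrA !ag.
have fi x i : i \in [:: H0; H1; H2] -> d = x + x + dv i ->
    F (c + (z + z) + d) = F' (c' + (z' + z') + d).
  move=> hi e.
  have [[h1 h2]|[h1 h2]] : hex r x /\ hex r (x + dv (nx i)) \/
      hex r (x + dv i) /\ hex r (x + dv i + dv (nx (opp i))).
    by move: hd; rewrite e; case: i hi {e} => // _; hlia.
  - exact: (fm x i).
  - by apply: (fm _ (opp i) h1 h2); rewrite e; case: i {hi e h1 h2}; plia.
have [x [[i|] [e hu]]] := parent d; first exact: (fi x i).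
have {}e : d = x + x by rewrite e /digit addr0.
have hx : hex r x by move: hd; rewrite e; hlia.
have -> : c + (z + z) + d = c + ((z + x) + (z + x)) by rewrite e; plia.
have -> : c' + (z' + z') + d = c' + ((z' + x) + (z' + x)) by rewrite e; plia.
by rewrite g0 g0' ag.
Qed.

Definition scale (m : int) (p : pos) : pos := (m * p.1, m * p.2).

(** [G] is reached from [F] by [n] coarsenings, its site 0 being the site [C] of
    [F]; its lattice has mesh 2^n. *)
Fixpoint tower (n : nat) (F : pos -> deco) (C : pos) (G : pos -> deco) : Prop :=
  if n is n'.+1 then
    exists c G1 C1, [/\ refines c F G1, tower n' G1 C1 G & C = c + (C1 + C1)]
  else C = 0 /\ G = F.

Lemma tower_legal n F : legal_deco F -> exists C G,
  [/\ tower n F C G, legal_deco G & nonexc F -> nonexc G].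
Proof.
elim: n F => [|n IH] F lF; first by exists 0, F.
have [c [G1 [r l1]]] := coarsen lF; have [C1 [G [t lG ne]]] := IH G1 l1.
exists (c + (C1 + C1)), G; split => //; first by exists c, G1, C1.
by move=> h; apply: ne; exact: (nonexc_coarse l1 r h).
Qed.

Lemma agree_tower n F F' C C' G G' z z' :
  tower n F C G -> tower n F' C' G' -> cluster G z = cluster G' z' ->
  agree (2 ^+ n) F F' (C + scale (2 ^+ n) z) (C' + scale (2 ^+ n) z').
Proof.
elim: n F F' C C' => [|n IH] F F' C C'.
  case=> -> -> [-> ->] /agree_cluster; rewrite expr0.
  have e x : 0 + scale 1 x = x by plia.
  by rewrite !e.
case=> c [G1 [C1 [r t ->]]] [c' [G1' [C1' [r' t' ->]]]] e.
have := agree_refines _ r r' (IH _ _ _ _ t t' e).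
rewrite -exprS exprS; set m := _ ^+ n => /(_ (exprn_ege1 _ _)) h.
have -> : c + (C1 + C1) + scale (2 * m) z = c + (C1 + scale m z + (C1 + scale m z)).
  by plia.
have -> : c' + (C1' + C1') + scale (2 * m) z' =
    c' + (C1' + scale m z' + (C1' + scale m z')) by plia.
exact: h.
Qed.

(** Every site is within two thirds of the mesh of the lattice of mesh [M], for
    the hexagonal norm; the extreme case is the center of a triangle. *)
Lemma round (M : int) (y : pos) : 0 < M ->
  exists z, let d := y - scale M z in hex (2 * M) (d + d + d).
Proof.
move=> M0.
have [q1 [a [e1 a0 aM]]] : exists q a, [/\ y.1 = M * q + a, 0 <= a & a < M].
  exists (y.1 %/ M)%Z, (y.1 %% M)%Z; rewrite mulrC -divz_eq; split => //.
    by apply: modz_ge0; lia.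
  by rewrite ltz_pmod.
have [q2 [b [e2 b0 bM]]] : exists q a, [/\ y.2 = M * q + a, 0 <= a & a < M].
  exists (y.2 %/ M)%Z, (y.2 %% M)%Z; rewrite mulrC -divz_eq; split => //.
    by apply: modz_ge0; lia.
  by rewrite ltz_pmod.
pose near_corner (s t : int) := hex (2 * M) (3 * (a - M * s), 3 * (b - M * t)).
have [s [t h]] : exists s t, near_corner s t.
  have : [|| near_corner 0 0, near_corner 1 0, near_corner 0 1 | near_corner 1 1].
    by rewrite /near_corner /hex /=; lia.
  by case/or4P => h; [exists 0, 0 | exists 1, 0 | exists 0, 1 | exists 1, 1].
exists (q1 + s, q2 + t) => /=; move: h; rewrite /near_corner /hex.
by rewrite !(add1, add2, opp1, opp2) /= e1 e2; lia.
Qed.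

Lemma pow2_gt (N : nat) : exists n, (N%:Z <= 2 ^+ n)%R.
Proof.
by exists N; elim: N => // n IH; rewrite exprS; lia.
Qed.

(** At a scale 2^n beyond three times [N], the ball of radius [N] lies inside the
    ball of radius 2^n around some coarse site, whose content is determined by a
    single coarse cluster; that cluster occurs at the same scale in [F']. *)
Theorem nonexc_repetitive F F' (N : nat) : legal_deco F -> nonexc F -> legal_deco F' ->
  exists t, forall y, hex N%:Z y -> F y = F' (y + t).
Proof.
move=> lF ne lF'; have [n hn] := pow2_gt (3 * N).
have [C [G [t lG /(_ ne) neG]]] := tower_legal n lF.
have [C' [G' [t' lG' _]]] := tower_legal n lF'.
have M0 : (0 < 2 ^+ n :> int) by rewrite exprn_gt0.
have [z hz] := round (- C) M0.
have [z' e] := nonexc_occurs z lG neG lG'.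
have ag := agree_tower t t' (esym e); move: hn hz ag; set m := _ ^+ n => hn hz ag.
exists (C' + scale m z' + (- C - scale m z)) => y hy.
have := ag (y + (- C - scale m z)).
have -> : C + scale m z + (y + (- C - scale m z)) = y by plia.
move=> ->; first by congr (F' _); plia.
by move: hy hz => /=; hlia.
Qed.

(** * Uniqueness of the exceptional decoration *)

Definition exc_nexts (E : seq (seq deco)) := undup [seq C <- nexts E | exc C].
Definition exc1 := exc_nexts [seq C <- clusters | exc C].
Definition exc2 := exc_nexts exc1.

(** In an exceptional cluster of a legal decoration, the central tile has its long
    stripe displaced toward the exceptional vertex, which is therefore in direction
    [D.1].  The site in direction [kappa D] is a hub; its own decoration is
    [next_deco D], the exceptional vertex being seen from there in the next
    direction and with the other colour. *)
Definition kappa (D : deco) : dir := opp (nx D.1).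
Definition next_deco (D : deco) : deco := (nx D.1, ~~ D.2).

Definition digit_ok (u : option dir) (C : seq deco) :=
  exc C ==> (u == Some (kappa (ctr C))) || (u == Some (opp (kappa (ctr C)))).
Definition next_ok (i : dir) (C1 C : seq deco) :=
  exc C && (i == opp (kappa (ctr C))) ==> (ctr C1 == next_deco (ctr C)).

(** An exceptional cluster with two levels above it is determined by its center,
    and its center determines where the hubs are and the decoration of the
    nearest one. *)
Lemma exc_checks :
  all (fun C => all (fun C' => (ctr C == ctr C') ==> (C == C')) exc2) exc2 &&
  all (fun C1 => all (fun u => digit_ok u (child u C1)) digits &&
                 all (fun i => next_ok i C1 (child (Some i) C1)) dirs) exc1.
Proof. vm_cast_no_check (erefl true). Qed.

Lemma ctr_cluster F y : ctr (cluster F y) = F y. Proof. by []. Qed.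

Lemma exc_nextsP C u E : C \in E -> u \in digits -> exc (child u C) -> child u C \in exc_nexts E.
Proof. by move=> hC hu e; rewrite mem_undup mem_filter e; apply: allpairs_f. Qed.

Lemma exc_coarse c F G z u : refines c F G -> legal_deco G ->
  exc (cluster F (c + (z + z) + digit u)) -> exc (cluster G z).
Proof.
move=> r lG; rewrite (cluster_child _ _ r).
by have [_ /(_ u) [_ h] _] := child_check (cluster_legal z lG).
Qed.

Lemma exc_parent F y : legal_deco F -> exc (cluster F y) -> exists c G z u,
  [/\ aligned F c, y = c + (z + z) + digit u, u \in digits & G = coarse c F] /\
  [/\ refines c F G, legal_deco G & exc (cluster G z)].
Proof.
move=> lF ey; have [c al] := exists_aligned lF.
have [z [u [e du]]] := parent (y - c).
have {}e : y = c + (z + z) + digit u by rewrite -addrA -e addrC subrK.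
have r := coarse_refines lF al; have lG := coarse_legal lF al.
exists c, (coarse c F), z, u; do 2 split => //.
by apply: (exc_coarse r lG (u := u)); rewrite -e.
Qed.

Lemma exc_mem1 F y : legal_deco F -> exc (cluster F y) -> cluster F y \in exc1.
Proof.
move=> lF ey; have [c [G [z [u [[_ e du _] [r lG ez]]]]]] := exc_parent lF ey.
have h : cluster G z \in [seq C <- clusters | exc C].
  by rewrite mem_filter ez; apply: cluster_legal.
move: ey; rewrite e (cluster_child _ _ r); exact: (exc_nextsP h du).
Qed.

Lemma exc_mem2 F y : legal_deco F -> exc (cluster F y) -> cluster F y \in exc2.
Proof.
move=> lF ey; have [c [G [z [u [[_ e du _] [r lG ez]]]]]] := exc_parent lF ey.
move: ey; rewrite e (cluster_child _ _ r); exact: (exc_nextsP (exc_mem1 lG ez) du).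
Qed.

Lemma exc_center F F' y y' : legal_deco F -> legal_deco F' ->
  exc (cluster F y) -> exc (cluster F' y') -> F y = F' y' -> cluster F y = cluster F' y'.
Proof.
move=> lF lF' /(exc_mem2 lF) h /(exc_mem2 lF') h' e.
have /andP [/allP /(_ _ h) /allP /(_ _ h') + _] := exc_checks.
by rewrite /cluster !ctrE e eqxx => /eqP.
Qed.

Lemma exc_coarsen F : legal_deco F -> exc (cluster F 0) -> exists G,
  [/\ refines (dv (kappa (F 0))) F G, legal_deco G, exc (cluster G 0) & G 0 = next_deco (F 0)].
Proof.
move=> lF e0; have [c0 [G0 [z [u [[al e du eG] [r lG ez]]]]]] := exc_parent lF e0.
have /andP [_ /allP chk] := exc_checks.
have /andP [/allP /(_ u du) + _] := chk _ (exc_mem1 lG ez).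
rewrite -(cluster_child _ _ r) -e /digit_ok ctr_cluster e0 => hu.
have al1 : aligned F (- digit u).
  have <- : c0 + (z + z) = - digit u by apply/eqP; rewrite -addr_eq0 -e.
  exact: aligned_shift.
have al2 : aligned F (dv (kappa (F 0))).
  case/orP: hu al1 => /eqP -> /=; last by rewrite dv_opp opprK.
  move=> /(aligned_shift (dv (kappa (F 0)))); congr aligned; plia.
have r2 := coarse_refines lF al2; have lG2 := coarse_legal lF al2.
have e2 : 0 = dv (kappa (F 0)) + (0 + 0) + digit (Some (opp (kappa (F 0)))).
  by rewrite /digit dv_opp; plia.
have ez2 : exc (cluster (coarse (dv (kappa (F 0))) F) 0).
  by apply: (exc_coarse r2 lG2 (u := Some (opp (kappa (F 0))))); rewrite -e2.
eexists; split; [exact: r2 | exact: lG2 | exact: ez2 |].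
have /andP [_ /allP /(_ _ (mem_dirs (opp (kappa (F 0)))))] := chk _ (exc_mem1 lG2 ez2).
by rewrite -(cluster_child _ _ r2) -e2 /next_ok e0 !ctr_cluster eqxx => /eqP.
Qed.

(** The last clause says that the exceptional vertex stays put: it is at a third
    of [wv k] from the origin at each scale, [k] being its direction. *)
Lemma exc_tower n F F' : legal_deco F -> legal_deco F' ->
  exc (cluster F 0) -> exc (cluster F' 0) -> F 0 = F' 0 ->
  exists C G G', [/\ tower n F C G, tower n F' C G', cluster G 0 = cluster G' 0 &
    exists k, scale 3 C = wv (F 0).1 - scale (2 ^+ n) (wv k)].
Proof.
elim: n F F' => [|n IH] F F' lF lF' e e' e0.
  exists 0, F, F'; split => //; first exact: exc_center.
  by exists (F 0).1; rewrite expr0; case: (F 0) => [[] ?]; plia.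
have [G1 [r l1 e1 n1]] := exc_coarsen lF e.
have [G1' [r' l1' e1' n1']] := exc_coarsen lF' e'.
have [|C [G [G' [t t' eG [k hk]]]]] := IH _ _ l1 l1' e1 e1'; first by rewrite n1 n1' e0.
exists (dv (kappa (F 0)) + (C + C)), G, G'; split => //.
- by exists (dv (kappa (F 0))), G1, C.
- by exists (dv (kappa (F 0))), G1', C; rewrite e0.
exists k; move: hk; rewrite n1 exprS; set m := _ ^+ n => hk.
have -> : scale 3 (dv (kappa (F 0)) + (C + C)) =
    scale 3 (dv (kappa (F 0))) + (scale 3 C + scale 3 C) by plia.
by rewrite hk /next_deco /kappa /scale; move: (wv k) => w; case: (F 0) => [[] ?]; plia.
Qed.

(** The clusters at 0 agree at all scales, and since the origins of all scales
    stay within two thirds of the mesh of the exceptional vertex, they determine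
    larger and larger balls around it. *)
Theorem exc_unique F F' : legal_deco F -> legal_deco F' ->
  exc (cluster F 0) -> exc (cluster F' 0) -> F 0 = F' 0 -> F =1 F'.
Proof.
move=> lF lF' e e' e0 y.
have [N hN] : exists N : nat, hex N%:Z y.
  by exists (absz y.1 + absz y.2)%N; hlia.
have [n hn] := pow2_gt (3 * N + 2).
have [C [G [G' [t t' eG [k hk]]]]] := exc_tower n lF lF' e e' e0.
have := agree_tower t t' eG; move: hn hk; set m := _ ^+ n => hn hk.
have -> : C + scale m 0 = C by plia.
move=> /(_ (y - C)); have -> : C + (y - C) = y by plia.
apply; move: (congr1 fst hk) (congr1 snd hk) hN hn.
rewrite /scale /wv ?(add1, add2, opp1, opp2) /=.
by case: k {hk}; case: (F 0).1 => /=; hlia.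
Qed.

(** * Limits of inflation *)

Definition hexnorm (p : pos) : nat := maxn (maxn (absz p.1) (absz p.2)) (absz (p.1 + p.2)%R).

Lemma hexnormE n p : (hexnorm p <= n)%N = hex n%:Z p.
Proof.
have e (a : int) : (absz a <= n)%N = (- n%:Z <= a) && (a <= n%:Z) by lia.
by rewrite /hexnorm !geq_max !e /hex !andbA.
Qed.

Lemma hexnorm_hex p : hex (hexnorm p)%:Z p. Proof. by rewrite -hexnormE. Qed.

Definition closer (p q : pos) : bool := (hexnorm p <= hexnorm q)%N.

Definition halve (p : pos) : pos := ((p.1 %/ 2)%Z, (p.2 %/ 2)%Z).

(** Among the two descriptions of a tile halfway, [sides] takes the one whose
    third hub is closer to the origin, so that inflation only looks at sites of
    about half the norm.  Three directions represent the classes modulo 2L. *)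
Definition infl0 (G : pos -> deco) (v : pos) : deco :=
  let sides i :=
    let x := halve (v - dv i) in
    if closer (x + dv (nx i)) (x + dv (pv i))
    then mid_deco i (G x) (G (x + dv (nx i)))
    else mid_deco (opp i) (G (x + dv i)) (G (x + dv (pv i))) in
  match (v.1 %% 2)%Z == 0, (v.2 %% 2)%Z == 0 with
  | true, true => G (halve v)
  | false, true => sides H0
  | true, false => sides H1
  | false, false => sides H2
  end.

Definition infl (c : pos) (G : pos -> deco) (y : pos) : deco := infl0 G (y - c).

Lemma infl_coarse c G z : infl c G (c + (z + z)) = G z.
Proof.
have p1 : ((z + z).1 %% 2)%Z == 0 by rewrite add1; lia.
have p2 : ((z + z).2 %% 2)%Z == 0 by rewrite add2; lia.
rewrite /infl addrC addKr /infl0 p1 p2.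
by congr G; rewrite /halve; plia.
Qed.

Lemma mid_deco_sym i X Y a b : edge_ok i X Y -> diam_ok (nx (nx i)) b a -> mid_deco (opp i) Y b = mid_deco i X a.
Proof.
rewrite /edge_ok /diam_ok /mid_deco.
have -> : opp (nx (nx i)) = pv i by case: i.
have -> : pv (opp i) = nx (nx i) by case: i.
have -> : opp (nx (nx i)) = pv i by case: i.
have -> : opp (pv i) = nx (nx i) by case: i.
by case: (first_end X i); case: (first_end Y _) => //= _; case: (red_deco a _); case: (red_deco b _).
Qed.

Lemma infl_sides c G z i : i \in [:: H0; H1; H2] ->
  infl c G (c + (z + z) + dv i) =
    if closer (z + dv (nx i)) (z + dv (pv i))
    then mid_deco i (G z) (G (z + dv (nx i)))
    else mid_deco (opp i) (G (z + dv i)) (G (z + dv (pv i))).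
Proof.
move=> hi; rewrite /infl.
have -> : c + (z + z) + dv i - c = z + z + dv i by plia.
have hz x : x = z + z -> halve x = z by move=> ->; rewrite /halve; plia.
have p1 : ((z + z + dv i).1 %% 2)%Z == 0 = if i is H1 then true else false.
  by case: i hi => // _; rewrite !add1 /=; lia.
have p2 : ((z + z + dv i).2 %% 2)%Z == 0 = if i is H0 then true else false.
  by clear p1; case: i hi => // _; rewrite !add2 /=; lia.
rewrite /infl0 p1 p2; clear p1 p2.
by case: i hi => // _; cbv beta iota zeta; rewrite hz //; plia.
Qed.

(** The rules give the tile halfway the same decoration from both of its ends. *)
Lemma infl_mid c G z i : edge_ok i (G z) (G (z + dv i)) ->
  diam_ok (nx (nx i)) (G (z + dv (pv i))) (G (z + dv (nx i))) ->
  infl c G (c + (z + z) + dv i) = mid_deco i (G z) (G (z + dv (nx i))).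
Proof.
move=> h1 h2.
have [hi|hi] : i \in [:: H0; H1; H2] \/ opp i \in [:: H0; H1; H2] by case: i {h1 h2}; auto.
  by rewrite infl_sides // (mid_deco_sym h1 h2) if_same.
have -> : c + (z + z) + dv i = c + ((z + dv i) + (z + dv i)) + dv (opp i).
  by rewrite dv_opp; plia.
rewrite infl_sides //.
have -> : opp (opp i) = i by case: i {h1 h2 hi}.
have -> : z + dv i + dv (opp i) = z by rewrite dv_opp addrK.
have -> : z + dv i + dv (nx (opp i)) = z + dv (pv i) by case: i {h1 h2 hi}; plia.
have -> : z + dv i + dv (pv (opp i)) = z + dv (nx i) by case: i {h1 h2 hi}; plia.
by rewrite (mid_deco_sym h1 h2) if_same.
Qed.

Lemma legal_deco_at F y : legal_deco F -> legal_cluster (cluster F y).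
Proof.
move=> lF; apply/allP => i _; rewrite ctr_cluster !armE; apply/and3P; split.
- by case: (lF y i).
- by have [+ _] := lF (y + dv i) (nx (nx i)); rewrite -addrA dv_nx.
have [_] := lF (y + dv (pv i)) (nx (nx i)).
by congr (diam_ok _ _ (F _)); case: i; plia.
Qed.

Definition legal_at F y := legal_cluster (cluster F y).

Lemma legal_atP F y i : legal_at F y ->
  [/\ edge_ok i (F y) (F (y + dv i)), edge_ok (nx (nx i)) (F (y + dv i)) (F (y + dv (nx i))) &
      diam_ok (nx (nx i)) (F (y + dv (pv i))) (F (y + dv (nx i)))].
Proof. by move=> /allP /(_ i (mem_dirs i)); rewrite ctr_cluster !armE => /and3P. Qed.

Lemma legal_at_deco F : (forall y, legal_at F y) -> legal_deco F.
Proof.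
move=> h y i; split; first by case: (legal_atP i (h y)).
have [_ _] := legal_atP (opp (nx i)) (h (y + dv i)).
have -> : nx (nx (opp (nx i))) = pv (pv (pv (pv (pv (pv i))))) by case: i.
have -> : pv (pv (pv (pv (pv (pv i))))) = i by case: i.
by congr (diam_ok _ (F _) (F _)); case: i; plia.
Qed.

Lemma edge_ok_sym i D D' : edge_ok i D D' -> edge_ok (opp i) D' D.
Proof. by rewrite /edge_ok eq_sym; case: i. Qed.
Lemma diam_ok_sym i D D' : diam_ok i D D' -> diam_ok (opp i) D' D.
Proof. by rewrite /diam_ok eq_sym; case: i. Qed.

Lemma offset_ring i j : offset (dv i) (dv j) =
  match subd j i with
  | H0 | H3 => None
  | H1 => Some (true, nx (nx i))
  | H2 => Some (false, opp i)
  | H4 => Some (false, opp (nx i))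
  | H5 => Some (true, opp (nx i))
  end.
Proof. by case: i; case: j; vm_compute. Qed.

Lemma legal_at_pair F y p q : legal_at F y -> p \in ball1 -> q \in ball1 ->
  pair_ok (offset p q) (F (y + p)) (F (y + q)).
Proof.
move=> ly.
have in1 x : x \in ball1 -> x = 0 \/ exists i, x = dv i.
  rewrite mem_cat => /orP [/mapP [i _ ->]|]; last by rewrite inE => /eqP ->; left.
  by right; exists i.
move=> /in1 [->|[i ->]] /in1 [->|[j ->]]; rewrite ?addr0.
- by vm_compute.
- have -> : offset 0 (dv j) = Some (true, j) by case: j; vm_compute.
  by case: (legal_atP j ly).
- have -> : offset (dv i) 0 = Some (true, opp i) by case: i; vm_compute.
  by apply: edge_ok_sym; case: (legal_atP i ly).
rewrite offset_ring; case E: (subd j i) => //=.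
- have -> : j = nx i by move: E; clear; case: i; case: j.
  by case: (legal_atP i ly).
- have -> : j = nx (nx i) by move: E; clear; case: i; case: j.
  by case: (legal_atP (nx i) ly) => h1 h2 h3; move: h3; clear; case: i.
- have -> : i = nx (nx j) by move: E; clear; case: i; case: j.
  by case: (legal_atP (nx j) ly) => h1 h2 /diam_ok_sym h3; move: h3; clear; case: j.
have -> : i = nx j by move: E; clear; case: i; case: j.
by case: (legal_atP j ly) => h1 /edge_ok_sym h2 h3; move: h2; clear; case: j.
Qed.

Lemma legal_at_cluster F y : legal_at F y -> cluster F y \in clusters.
Proof.
move=> ly; rewrite clusterE; apply: extends_view_at => // [p q|].
  exact: legal_at_pair.
by apply/mapP; exists (F y); rewrite ?mem_decos //= /view /= addr0.
Qed.

Lemma infl_cluster c G z u : legal_at G z -> (forall i, legal_at G (z + dv i)) ->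
  cluster (infl c G) (c + (z + z) + digit u) = child u (cluster G z).
Proof.
move=> h0 h1; apply: cluster_child_local => [x|i|i]; first exact: infl_coarse.
  by case: (legal_atP i h0) => ? _ ?; rewrite infl_mid.
have e : z + dv i + dv (nx (nx (nx i))) = z by case: i; plia.
by case: (legal_atP (nx (nx i)) (h1 i)) => ? _ ?; rewrite infl_mid // e.
Qed.

(** Inflation is contracting: a ball of radius [R] determines a ball of radius
    2R - 2, the loss being due to the shift [c] and to the midpoints.  Radius 3 is
    the first one that grows, whence the bases at radius 3 below. *)
Lemma infl_local c G G' y R : (hexnorm c <= 1)%N -> (2 <= R)%N -> (hexnorm y + 2 <= R + R)%N ->
  (forall x, (hexnorm x <= R)%N -> G x = G' x) -> infl c G y = infl c G' y.
Proof.
rewrite hexnormE => hc hR hy e; have {hy} : (hexnorm y <= R + R - 2)%N by lia.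
rewrite hexnormE => hy.
have key x i : i \in [:: H0; H1; H2] -> y = c + (x + x) + dv i ->
    infl c G y = infl c G' y.
  move=> hi ey; rewrite ey !infl_sides //.
  have [hx hxi hab] : [/\ hex R x, hex R (x + dv i) &
      hex R (x + dv (nx i)) || hex R (x + dv (pv i))].
    move: hy hc; rewrite ey; clear ey e; case: i hi => // _ hy hc;
      split; move: hy hc; hlia.
  rewrite -!hexnormE in hx hxi hab.
  have [ha hb] :
      (closer (x + dv (nx i)) (x + dv (pv i)) -> leq (hexnorm (x + dv (nx i))) R) /\
      (~~ closer (x + dv (nx i)) (x + dv (pv i)) -> leq (hexnorm (x + dv (pv i))) R).
    by move: hab; rewrite /closer; move: (hexnorm _) (hexnorm _) => a b; lia.
  by case: ifP ha hb => _ ha hb; rewrite !e // ?ha ?hb.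
have [x [[i|] [ex hi]]] := parent (y - c).
  have {}ex : y = c + (x + x) + dv i by rewrite -addrA -ex addrC subrK.
  exact: (key x i hi ex).
have {}ex : y = c + (x + x) by rewrite /digit addr0 in ex; rewrite -ex addrC subrK.
rewrite ex !infl_coarse e //; rewrite hexnormE; move: hy hc; rewrite ex; hlia.
Qed.

Lemma hexnorm_step z i : (hexnorm (z + dv i)%R <= hexnorm z + 1)%N.
Proof. by rewrite hexnormE; move: (hexnorm_hex z); case: i; hlia. Qed.

Lemma parent_near (y c : pos) : (hexnorm c <= 1)%N -> (4 <= hexnorm y)%N -> exists z u,
  [/\ y = c + (z + z) + digit u, (hexnorm z < hexnorm y)%N & forall i, (hexnorm (z + dv i)%R < hexnorm y)%N].
Proof.
move=> hc hy.
have half (z : pos) : hex (hexnorm y).+1%:Z (z + z) -> (hexnorm z + hexnorm z <= hexnorm y + 1)%N.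
  rewrite -hexnormE; move: (hexnorm y) => n; rewrite /hexnorm !(add1, add2).
  have -> : z.1 + z.1 + (z.2 + z.2) = (z.1 + z.2) + (z.1 + z.2) by lia.
  have e (a : int) : absz (a + a)%R = (absz a + absz a)%N by lia.
  rewrite !e; move: (absz z.1) (absz z.2) (absz (z.1 + z.2)) => a b d; lia.
suff [z [u [e hz]]] : exists z u, y = c + (z + z) + digit u /\ (hexnorm z + hexnorm z <= hexnorm y + 1)%N.
  by exists z, u; split => // [|i]; [lia | apply: leq_ltn_trans (hexnorm_step z i) _; lia].
move: hc (hexnorm_hex y); rewrite hexnormE => hc hyy.
have [x [[i|] [ex hi]]] := parent (y - c); last first.
  rewrite /digit addr0 in ex.
  exists x, None; split; first by rewrite /digit addr0 -ex addrC subrK.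
  by apply: half; rewrite -ex; move: hc hyy; hlia.
have {}ex : y = c + (x + x) + dv i by rewrite -addrA -ex addrC subrK.
have : hex (hexnorm y).+1%:Z (x + x) || hex (hexnorm y).+1%:Z (x + dv i + (x + dv i)).
  move: (hexnorm y) hyy hc {half hy} => n; rewrite ex; clear ex.
  by case: i hi => // _; hlia.
case/orP => /half h; first by exists x, (Some i).
exists (x + dv i), (Some (opp i)); split => //.
by rewrite {1}ex /digit dv_opp; plia.
Qed.

(** The shift [c] and the [seed] alternate between two values, because an
    inflation centered at a vertex turns the triangle around it upside down. *)
Fixpoint iterate (c : bool -> pos) (seed : bool -> pos -> deco) (n : nat) (b : bool) :
    pos -> deco :=
  if n is n'.+1 then infl (c b) (iterate c seed n' (~~ b)) else seed b.

Definition range3 : seq int := [:: -3; -2; -1; 0; 1; 2; 3].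
Definition ball3 : seq pos := [seq p <- [seq (a, b) | a <- range3, b <- range3] | hexnorm p <= 3]%N.

Lemma mem_ball3 y : (hexnorm y <= 3)%N -> y \in ball3.
Proof.
move=> h; rewrite mem_filter h andTb.
have r3 (a : int) : (absz a <= 3)%N -> a \in range3.
  by rewrite !inE; case: a => [] [|[|[|[|n]]]] //=; lia.
case: y h => a b; rewrite hexnormE => h; apply/allpairsP; exists (a, b).
by split => //; apply: r3; move: h; hlia.
Qed.

(** A seed of seven tiles need not be right further out; after three inflations
    the ball of radius 3 does not change any more and obeys the rules. *)
Definition stable_at3 c seed := all (fun b : bool => all (fun y =>
   (iterate c seed 4 b y == iterate c seed 3 b y) && legal_at (iterate c seed 4 b) y)
   ball3) [:: false; true].

Section Limit.
Variables (c : bool -> pos) (seed : bool -> pos -> deco).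
Hypothesis c1 : forall b, (hexnorm (c b) <= 1)%N.
Hypothesis base : stable_at3 c seed.

Let it := iterate c seed.

Lemma base_at b y : (hexnorm y <= 3)%N -> it 4 b y = it 3 b y /\ legal_at (it 4 b) y.
Proof.
move=> /mem_ball3 hy.
have h : all (fun y => (it 4 b y == it 3 b y) && legal_at (it 4 b) y) ball3.
  have /allP hb : all (fun b : bool => all (fun y =>
    (it 4 b y == it 3 b y) && legal_at (it 4 b) y) ball3) [:: false; true] := base.
  by apply: (hb b); case: b.
by have /andP [/eqP e l] := allP h y hy; exact: conj e l.
Qed.

Lemma iterate_stable n b y : (3 <= n)%N -> (hexnorm y <= n)%N -> it n.+1 b y = it n b y.
Proof.
elim: n b y => // n IH b y; rewrite leq_eqVlt => /orP [/eqP [<-]|h3 hy].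
  by move=> /(base_at b) [].
rewrite /it /=; apply: (@infl_local _ _ _ _ n); [exact: c1 | lia | lia |].
by move=> x hx; apply: IH.
Qed.

Lemma iterate_ge n k b y : (3 <= n)%N -> (hexnorm y <= n)%N -> it (k + n) b y = it n b y.
Proof.
by move=> h3 hy; elim: k => // k <-; rewrite addSn; apply: iterate_stable; lia.
Qed.

Definition limit (b : bool) (y : pos) : deco := it (3 + hexnorm y) b y.

Lemma limitE n b y : (3 <= n)%N -> (hexnorm y <= n)%N -> limit b y = it n b y.
Proof.
move=> h3 hy; rewrite -(iterate_ge (3 + hexnorm y) _ h3 hy) addnC.
by rewrite iterate_ge //; exact: leq_addl.
Qed.

Lemma limit_infl b : limit b =1 infl (c b) (limit (~~ b)).
Proof.
move=> y; rewrite (@limitE (hexnorm y + 3).+1); [|lia|lia].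
apply: (@infl_local _ _ _ _ (hexnorm y + 3)); [exact: c1 | lia | lia |].
by move=> x hx; rewrite (@limitE (hexnorm y + 3)) //; lia.
Qed.

Lemma eq_cluster F F' y : F =1 F' -> cluster F y = cluster F' y.
Proof. by move=> e; rewrite /cluster e; apply: eq_mkC => i; rewrite e. Qed.

Lemma limit_cluster4 b y : (hexnorm y <= 3)%N -> cluster (limit b) y = cluster (it 4 b) y.
Proof.
move=> hy.
have e x : (hexnorm x <= 4)%N -> limit b x = it 4 b x by move=> hx; apply: limitE.
rewrite /cluster (e y); last exact: leqW.
apply: eq_mkC => i; apply: e; apply: leq_trans (hexnorm_step y i) _.
by rewrite addn1.
Qed.

(** Away from the base, a cluster is the child of a cluster closer to the origin,
    and refinement preserves the rules. *)
Lemma limit_legal b : legal_deco (limit b).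
Proof.
apply: legal_at_deco => y; have [n] := ubnP (hexnorm y); elim: n b y => // n IH b y hy.
have [h|h] := leqP (hexnorm y) 3.
  by have [_ l] := base_at b h; rewrite /legal_at (limit_cluster4 _ h); exact: l.
have [z [u [e hz hzi]]] := parent_near (c1 b) h.
rewrite /legal_at (eq_cluster _ (limit_infl b)) {1}e infl_cluster.
- have lz : legal_at (limit (~~ b)) z by apply: IH; lia.
  by have [_ /(_ u) [l _] _] := child_check (legal_at_cluster lz); exact: l.
- by apply: IH; lia.
by move=> i; apply: IH; have := hzi i; lia.
Qed.

Lemma limit_nonexc :
  all (fun b : bool => all (fun y => ~~ exc (cluster (it 4 b) y)) ball3) [:: false; true] ->
  forall b, nonexc (limit b).
Proof.
move=> /allP ne b y; have [n] := ubnP (hexnorm y); elim: n b y => // n IH b y hy.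
have [h|h] := leqP (hexnorm y) 3.
  have hb : b \in [:: false; true] by case: (b).
  rewrite (limit_cluster4 _ h); exact: (allP (ne b hb) y (mem_ball3 h)).
have [z [u [e hz hzi]]] := parent_near (c1 b) h.
have lz x : legal_at (limit (~~ b)) x := legal_deco_at x (limit_legal _).
rewrite (eq_cluster _ (limit_infl b)) {1}e infl_cluster //.
have [_ /(_ u) [_ h'] _] := child_check (legal_at_cluster (lz z)).
by apply/negP => /h'; apply/negP; apply: IH; lia.
Qed.
End Limit.

(** * Two legal decorations *)

Definition seed_of (C : seq deco) (y : pos) : deco :=
  if y == 0 then ctr C else
  if [seq i <- dirs | y == dv i] is i :: _ then arm C i else proto_deco.

(** The limit centered at a tile: the origin is a hub at every scale. *)
Definition origin_shift (b : bool) : pos := 0.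
Definition origin_seed (b : bool) := seed_of (core proto_deco).

Lemma origin_base : stable_at3 origin_shift origin_seed.
Proof. vm_cast_no_check (erefl true). Qed.

Definition regular := limit origin_shift origin_seed false.

Lemma regular_legal : legal_deco regular.
Proof. by apply: limit_legal origin_base _ => -[]. Qed.

Lemma regular_nonexc : nonexc regular.
Proof.
apply: limit_nonexc origin_base _ _; first by case.
vm_cast_no_check (erefl true).
Qed.

(** The limit centered at a vertex: the exceptional vertex is, alternately, the
    one in direction [H0] and the one in direction [H1] from the origin, and the
    shifts are neighbouring hubs: the one given by [kappa] in the first case, the
    opposite one in the second, so that the vertex swings back. *)
Definition vertex_shift (b : bool) : pos := if b then dv H2 else dv H4.
Definition star (b : bool) : seq deco := Eval vm_compute in
  head [::] [seq C <- exc2 | ctr C == (if b then (H1, true) else proto_deco)].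
Definition vertex_seed (b : bool) := seed_of (star b).

Lemma vertex_base : stable_at3 vertex_shift vertex_seed.
Proof. vm_cast_no_check (erefl true). Qed.

Definition singular := limit vertex_shift vertex_seed false.

Lemma singular_legal : legal_deco singular.
Proof. by apply: limit_legal vertex_base _ => -[]. Qed.

Lemma singular0 : singular 0 = proto_deco.
Proof. by vm_compute. Qed.

Lemma singular_exc : exc (cluster singular 0).
Proof. by vm_compute. Qed.

Section Coordinates.
Variable R : realType.
Implicit Types (p q : plane R) (g t s : motion R).

(** * Oblique coordinates and motions *)

Definition ht : R := Num.sqrt 3 / 2.
Lemma ht2 : ht * ht = 3 / 4.
Proof. by rewrite /ht mulrACA -expr2 sqr_sqrtr //; field. Qed.
Lemma ht_gt0 : 0 < ht.
Proof. by rewrite divr_gt0 // sqrtr_gt0. Qed.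
Lemma ht_lt1 : ht < 1.
Proof. have := ht2; have := ht_gt0; nra. Qed.

(** The point a + b w of the complex plane, where w is the sixth root of unity
    of argument 60 degrees.  In these coordinates vertices and centers of tiles are
    integral, and turns are multiplications by integral matrices. *)
Definition pt (a b : R) : plane R := (a + b / 2, b * ht).
Definition dsq p q : R := (p.1 - q.1) ^+ 2 + (p.2 - q.2) ^+ 2.
(** The squared Euclidean norm of [pt a b]. *)
Definition sqn (a b : R) : R := a * a + a * b + b * b.

Lemma pt_surj p : exists a b, p = pt a b.
Proof.
exists (p.1 - p.2 / ht / 2), (p.2 / ht); rewrite /pt subrK divfK; first by case: p.
by rewrite gt_eqF // ht_gt0.
Qed.

Lemma pt_inj a b a' b' : pt a b = pt a' b' -> a = a' /\ b = b'.
Proof.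
case=> e1 /mulIf e2; have {}e2 : b = b' by apply: e2; rewrite gt_eqF // ht_gt0.
by split => //; move: e1; rewrite e2; lra.
Qed.

Lemma dsqE a b a' b' : dsq (pt a b) (pt a' b') = sqn (a - a') (b - b').
Proof.
rewrite /dsq /pt /sqn /= -mulrBl exprMn (expr2 ht) ht2.
by field.
Qed.

Lemma conj_pt a b : conjp (pt a b) = pt (a + b) (- b).
Proof. by rewrite /conjp /pt /=; congr (_, _); [field | ring]. Qed.

Lemma mul_pt a b c d : mulp (pt a b) (pt c d) = pt (a * c - b * d) (a * d + b * c + b * d).
Proof.
rewrite /mulp /pt /=; congr (_, _); last by field.
have -> : b * ht * (d * ht) = b * d * (ht * ht) by ring.
by rewrite ht2; field.
Qed.

Definition mpt (m : pos) : plane R := pt m.1%:~R m.2%:~R.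
(** Multiplication and conjugation of Eisenstein integers. *)
Definition mulz (m n : pos) : pos := (m.1 * n.1 - m.2 * n.2, m.1 * n.2 + m.2 * n.1 + m.2 * n.2).
Definition conjz (m : pos) : pos := (m.1 + m.2, - m.2).

Lemma mul_mpt m n : mulp (mpt m) (mpt n) = mpt (mulz m n).
Proof. by rewrite mul_pt /mpt /mulz /= !intrD !intrM mulrNz !intrM. Qed.
Lemma conj_mpt m : conjp (mpt m) = mpt (conjz m).
Proof. by rewrite conj_pt /mpt /conjz /= intrD mulrNz. Qed.
Lemma mptD m n : ((mpt m).1 + (mpt n).1, (mpt m).2 + (mpt n).2) = mpt (m + n).
Proof. by rewrite /mpt /pt /= !intrD; congr (_, _); field. Qed.
Lemma mpt_inj : injective mpt.
Proof. by move=> m n /pt_inj [/intr_inj e1 /intr_inj e2]; apply: posP. Qed.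

Lemma motion_eq g t : shift g = shift t -> turn g = turn t -> mirror g = mirror t -> g = t.
Proof.
case: g => s u m h; case: t => s' u' m' h' /= e1 e2 e3.
by subst; congr Motion; apply: eq_irrelevance.
Qed.

Definition idm : motion R := @Motion R (0, 0) (1, 0) false
  (introT eqP (etrans (congr2 +%R (expr1n _ 2) (expr0n _ 2)) (addr0 _))).

Lemma act_id p : act idm p = p.
Proof. by rewrite /act /mulp /=; case: p => a b /=; congr (_, _); ring. Qed.

Lemma compA g t s : comp (comp g t) s = comp g (comp t s).
Proof.
apply: motion_eq; rewrite /= ?act_comp //; last by rewrite addbA.
rewrite /comp_turn /= /comp_turn /mulp /conjp /=.
by case: (mirror g); case: (mirror t) => /=; congr (_, _); ring.
Qed.

Definition undo g p : plane R :=
  let q := mulp (conjp (turn g)) (p.1 - (shift g).1, p.2 - (shift g).2) in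
  if mirror g then conjp q else q.

Lemma actK g p : act g (undo g p) = p.
Proof.
have /eqP := turn_unit g; rewrite /act /undo /mulp /conjp.
case: p => a b; case: (turn g) => u v; case: (shift g) => x y /= h.
by case: (mirror g) => /=; congr (_, _);
  [transitivity (x + (u ^+ 2 + v ^+ 2) * (a - x)) | transitivity (y + (u ^+ 2 + v ^+ 2) * (b - y))
  | transitivity (x + (u ^+ 2 + v ^+ 2) * (a - x)) | transitivity (y + (u ^+ 2 + v ^+ 2) * (b - y))];
  first [by ring | by rewrite h; ring].
Qed.

Lemma dsq_act g p q : dsq (act g p) (act g q) = dsq p q.
Proof.
have /eqP h := turn_unit g; rewrite -[RHS]mul1r -h /dsq /act /mulp /conjp.
by case: (mirror g) => /=; ring.
Qed.

Lemma dsq_eq0 p q : dsq p q <= 0 -> p = q.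
Proof.
case: p q => a b [c d]; rewrite /dsq /= => h.
have : (a - c) ^+ 2 = 0 by apply/eqP; rewrite eq_le sqr_ge0 andbT; have := sqr_ge0 (b - d); lra.
have : (b - d) ^+ 2 = 0 by apply/eqP; rewrite eq_le sqr_ge0 andbT; have := sqr_ge0 (a - c); lra.
by move=> /eqP; rewrite sqrf_eq0 subr_eq0 => /eqP -> /eqP; rewrite sqrf_eq0 subr_eq0 => /eqP ->.
Qed.

Lemma dsqxx p : dsq p p = 0. Proof. by rewrite /dsq !subrr expr0n addr0. Qed.
Lemma dsqC p q : dsq p q = dsq q p. Proof. by rewrite /dsq; ring. Qed.

Lemma act_inj g : injective (act g).
Proof. by move=> p q e; apply: dsq_eq0; rewrite -(dsq_act g) e dsqxx. Qed.

Lemma comp_surj g t : exists s, comp g s = t.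
Proof.
pose u := mulp (conjp (turn g)) (turn t).
pose v := if mirror g then conjp u else u.
have hv : v.1 ^+ 2 + v.2 ^+ 2 == 1.
  have /eqP h := turn_unit g; have /eqP h' := turn_unit t; apply/eqP.
  transitivity (((turn g).1 ^+ 2 + (turn g).2 ^+ 2) * ((turn t).1 ^+ 2 + (turn t).2 ^+ 2)).
    by rewrite /v /u /mulp /conjp; case: (mirror g) => /=; ring.
  by rewrite h h' mulr1.
exists (@Motion R (undo g (shift t)) v (mirror g (+) mirror t) hv).
apply: motion_eq => /=; [exact: actK | | by case: (mirror g); case: (mirror t)].
have /eqP := turn_unit g; rewrite /comp_turn /= /v /u /mulp /conjp.
case: (turn t) => a b; case: (turn g) => x y /= h.
by case: (mirror g) => /=; congr (_, _);
  [transitivity ((x ^+ 2 + y ^+ 2) * a) | transitivity ((x ^+ 2 + y ^+ 2) * b)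
  | transitivity ((x ^+ 2 + y ^+ 2) * a) | transitivity ((x ^+ 2 + y ^+ 2) * b)];
  first [by ring | by rewrite h mul1r].
Qed.

Lemma comp_inj g t s : comp g t = comp g s -> t = s.
Proof.
move=> e; have em := congr1 (@mirror R) e; have es := congr1 (@shift R) e.
have et := congr1 (@turn R) e; rewrite /= in em es et.
apply: motion_eq; [exact: (act_inj es) | | by move: em; do 3 case: (mirror _)].
have : act (@Motion R (0, 0) (turn g) (mirror g) (turn_unit g)) (turn t) =
       act (@Motion R (0, 0) (turn g) (mirror g) (turn_unit g)) (turn s).
  by move: et; rewrite /act /comp_turn; cbn [shift turn mirror] => ->.
exact: act_inj.
Qed.

Lemma comp1 g : comp idm g = g.
Proof.
apply: motion_eq => //=; first exact: act_id.
by rewrite /comp_turn /mulp /=; case: (turn g) => a b /=; congr (_, _); ring.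
Qed.

Lemma inverse_motion g : exists h, forall t, comp h (comp g t) = t.
Proof.
have [h e] := comp_surj g idm; exists h => t; apply: (@comp_inj g).
by rewrite -compA e comp1.
Qed.

End Coordinates.

Section Hexagon.
Variable R : realType.
Implicit Types (p q : plane R) (g t s : motion R).

(** * The hexagon, packing and covering *)

(** The hexagon in oblique coordinates: one inequality for each pair of opposite
    edges. *)
Definition hexR (a b : R) : Prop :=
  [/\ -1 <= a <= 1, -1 <= b <= 1 & -1 <= a + b <= 1].

Lemma hexR_sqn a b : hexR a b -> sqn a b <= 1.
Proof.
rewrite /sqn => -[/andP [? ?] /andP [? ?] /andP [? ?]].
have [ha|/ltW ha] := lerP 0 a; have [hb|/ltW hb] := lerP 0 b; nra.
Qed.

Definition zdir (i : dir) : 'Z_6 := inZp (dir_nat i).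
Definition dirz (k : 'Z_6) : dir := nat_dir k.
Lemma zdirK i : dirz (zdir i) = i. Proof. by case: i. Qed.
Lemma dirzK k : zdir (dirz k) = k.
Proof. by case: k => [[|[|[|[|[|[|k]]]]]] hk] //; apply: val_inj. Qed.
Lemma dirzS k : dirz (k + 1) = nx (dirz k).
Proof. by rewrite -[k]dirzK; case: (dirz k). Qed.

Lemma sum6 (V : nmodType) (f : 'Z_6 -> V) : \sum_k f k =
  f (zdir H0) + (f (zdir H1) + (f (zdir H2) + (f (zdir H3) + (f (zdir H4) + f (zdir H5))))).
Proof.
rewrite !big_ord_recl big_ord0 addr0.
by do ![congr (_ + _)]; congr f; apply: val_inj.
Qed.

Lemma proto_vertexE k : proto_vertex R k = mpt R (dv (dirz k)).
Proof.
rewrite -[k]dirzK zdirK /proto_vertex /mpt /pt /ht.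
by case: (dirz k) => /=; congr (_, _); field.
Qed.

Lemma hexagonE a b : proto_hexagon (pt a b) <-> hexR a b.
Proof.
split=> [[w [w0 w1 e]]|].
  have [ea eb] : a = \sum_k w k * (dv (dirz k)).1%:~R /\ b = \sum_k w k * (dv (dirz k)).2%:~R.
    apply: pt_inj; rewrite e.
    under eq_bigr => k _ do rewrite proto_vertexE.
    rewrite !sum6 !zdirK /pt /mpt /=; congr (_, _) => /=.
    - by rewrite /pt /GRing.scale /=; ring.
    - by rewrite /pt /GRing.scale /=; ring.
  have h6 := sum6 w; rewrite w1 in h6.
  move: (w0 (zdir H0)) (w0 (zdir H1)) (w0 (zdir H2)) (w0 (zdir H3)) (w0 (zdir H4)) (w0 (zdir H5)).
  rewrite ea eb !sum6 !zdirK /= in h6 * => ? ? ? ? ? ?.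
  by split; apply/andP; split; lra.
case=> /andP [a1 a2] /andP [b1 b2] /andP [c1 c2].
suff [w [w0 w1 wa wb]] : exists w : dir -> R, [/\ forall i, 0 <= w i,
    w H0 + w H1 + w H2 + w H3 + w H4 + w H5 = 1,
    w H0 - w H2 - w H3 + w H5 = a & w H1 + w H2 - w H4 - w H5 = b].
  exists (fun k => w (dirz k)); split => //.
    by rewrite sum6 !zdirK -w1; ring.
  under eq_bigr => k _ do rewrite proto_vertexE.
  rewrite !sum6 !zdirK -wa -wb /mpt /pt /GRing.scale /=.
  by congr (_, _) => /=; rewrite /GRing.scale /=; field.
(* In the sector between two consecutive vertices, use these two vertices and
   spread the remaining weight evenly over all six, whose sum is 0. *)
have sector (x y : R) i : 0 <= x -> 0 <= y -> x + y <= 1 ->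
    a = x * (dv i).1%:~R + y * (dv (nx i)).1%:~R ->
    b = x * (dv i).2%:~R + y * (dv (nx i)).2%:~R ->
    exists w : dir -> R, [/\ forall i, 0 <= w i,
    w H0 + w H1 + w H2 + w H3 + w H4 + w H5 = 1,
    w H0 - w H2 - w H3 + w H5 = a & w H1 + w H2 - w H4 - w H5 = b].
  move=> x0 y0 xy -> ->.
  exists (fun j => (1 - x - y) / 6 + (if j == i then x else 0) + (if j == nx i then y else 0)).
  split; [move=> j | | |].
  - by case: ifP => _; case: ifP => _; lra.
  - by case: i => /=; lra.
  - by case: i => /=; lra.
  - by case: i => /=; lra.
have [ha|/ltW ha] := lerP 0 a; have [hb|/ltW hb] := lerP 0 b.
- by apply: (sector a b H0) => /=; lra.
- have [h|/ltW h] := lerP 0 (a + b).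
    by apply: (sector (- b) (a + b) H5) => /=; lra.
  by apply: (sector (- (a + b)) a H4) => /=; lra.
- have [h|/ltW h] := lerP 0 (a + b).
    by apply: (sector (a + b) (- a) H1) => /=; lra.
  by apply: (sector b (- (a + b)) H2) => /=; lra.
by apply: (sector (- a) (- b) H3) => /=; lra.
Qed.

Lemma act0 t : act t (0, 0) = shift t.
Proof.
rewrite /act /mulp /conjp; case: (mirror t); case: (shift t) => a b /=;
  by congr (_, _); ring.
Qed.

Lemma body_dsq t p : body t p -> dsq p (shift t) <= 1.
Proof.
case=> q hq <-; rewrite -act0 dsq_act; move: hq.
have [a [b ->]] := pt_surj q => /hexagonE /hexR_sqn.
have -> : (0, 0) = pt 0 0 :> plane R by rewrite /pt !mul0r addr0.
by rewrite dsqE !subr0.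
Qed.

Lemma dsq_body t p : dsq p (shift t) <= 3 / 4 -> body t p.
Proof.
rewrite -act0 -{1}(actK t p) dsq_act => h; exists (undo t p); last exact: actK.
move: h; have [a [b ->]] := pt_surj (undo t p).
have -> : (0, 0) = pt 0 0 :> plane R by rewrite /pt !mul0r addr0.
rewrite dsqE !subr0 /sqn => h; apply/hexagonE.
have sq1 (x : R) : x * x <= 1 -> -1 <= x <= 1 by move=> hx; apply/andP; split; nra.
have hb := sqr_ge0 (b + a / 2); have ha := sqr_ge0 (a + b / 2); have hab := sqr_ge0 (a - b).
by rewrite !expr2 in ha hb hab; split; apply: sq1; lra.
Qed.

Lemma dsq_interior t p : dsq p (shift t) < 3 / 4 -> interior (body t) p.
Proof.
move=> h; apply/nbhs_ballP => /=; have [d dE] : exists d, d = 3 / 4 - dsq p (shift t) by eexists.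
have d0 : 0 < d by rewrite dE; lra.
exists (d / 8) => /=; first by lra.
move=> q [/= h1 h2]; apply: dsq_body; apply: ltW.
move: h1 h2; rewrite /ball /= !ltr_norml => /andP [u1 u2] /andP [v1 v2].
rewrite /dsq in dE *; set x := p.1 - (shift t).1 in dE; set y := p.2 - (shift t).2 in dE.
set u := p.1 - q.1 in u1 u2; set v := p.2 - q.2 in v1 v2.
have -> : q.1 - (shift t).1 = x - u by rewrite /x /u; ring.
have -> : q.2 - (shift t).2 = y - v by rewrite /y /v; ring.
have := sqr_ge0 x; have := sqr_ge0 y; rewrite !expr2 in dE * => hy hx.
have d1 : d <= 1 by lra.
have bound (a b : R) : a * a <= 3 / 4 -> - (d / 8) < b -> b < d / 8 ->
    (a - b) * (a - b) <= a * a + 3 * d / 8.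
  by move=> ha b1 b2; have [?|/ltW ?] := lerP 0 a; have [?|/ltW ?] := lerP 0 b; nra.
have := bound x u; have := bound y v; lra.
Qed.

(** The two metric properties of a tiling that locate its centers. *)
Definition apart (T : set (motion R)) :=
  forall t t', T t -> T t' -> t <> t' -> 3 <= dsq (shift t) (shift t').
Definition covers (T : set (motion R)) := forall p, exists2 t, T t & body t p.

(** Otherwise the midpoint of two centers is interior to both inscribed disks. *)
Lemma tiling_apart T : tiling T -> apart T.
Proof.
move=> [_ dj] t t' Tt Tt' ne; rewrite leNgt; apply/negP => h.
pose m : plane R := (((shift t).1 + (shift t').1) / 2, ((shift t).2 + (shift t').2) / 2).
have : (interior (body t) `&` interior (body t')) m.
  by split; apply: dsq_interior; move: h; rewrite /dsq /m /=; lra.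
by rewrite dj.
Qed.

Definition pull g (T : set (motion R)) : set (motion R) := [set s | T (comp g s)].

Lemma pull_apart g T : apart T -> apart (pull g T).
Proof.
move=> a s s' Ts Ts' ne; have := a _ _ Ts Ts' (fun e => ne (comp_inj e)).
by rewrite /= dsq_act.
Qed.

Lemma body_comp g t p : body (comp g t) (act g p) <-> body t p.
Proof.
split=> [[q hq]|[q hq <-]]; last by exists q; rewrite ?act_comp.
by rewrite act_comp => /act_inj <-; exists q.
Qed.

Lemma pull_covers g T : covers T -> covers (pull g T).
Proof.
move=> c p; have [t Tt] := c (act g p); have [s e] := comp_surj g t.
by rewrite -e => /body_comp b; exists s => //; rewrite /pull /= e.
Qed.

End Hexagon.

Section Rigidity.
Variable R : realType.
Implicit Types (p q : plane R) (g t s : motion R) (T : set (motion R)).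

(** * Rigidity of the lattice of centers *)

Definition center T p := exists2 t, T t & shift t = p.

Lemma center_apart T p q : apart T -> center T p -> center T q -> p <> q -> 3 <= dsq p q.
Proof.
by move=> a [t Tt <-] [t' Tt' <-] ne; apply: a => // e; apply: ne; rewrite e.
Qed.

Lemma center_near T p q : apart T -> center T p -> center T q -> dsq p q < 3 -> p = q.
Proof.
move=> a cp cq h; apply: contrapT => ne; have := center_apart a cp cq ne; lra.
Qed.

Lemma center_covers T p : covers T -> exists2 z, center T z & dsq p z <= 1.
Proof. by move=> c; have [t Tt /body_dsq h] := c p; exists (shift t) => //; exists t. Qed.

(** The point displayed is the center, on the left of the oriented segment from
    [p] to [q], of a circle of squared radius [r] through both points.  As the
    radius exceeds 1, the tile that covers this point is a third one. *)
Lemma circle T p q (r : R) : apart T -> covers T -> center T p -> center T q ->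
  p <> q -> dsq p q <= 4 * r -> 1 < r ->
  exists z k, [/\ center T z, 0 <= k, dsq p q * (1 + k ^+ 2) = 4 * r,
    3 <= dsq z p /\ 3 <= dsq z q &
    dsq z ((p.1 + q.1) / 2 - k * (q.2 - p.2) / 2, (p.2 + q.2) / 2 + k * (q.1 - p.1) / 2) <= 1].
Proof.
move=> a c cp cq ne hr r1.
have d3 := center_apart a cp cq ne.
pose k := Num.sqrt (4 * r / dsq p q - 1).
have hk : dsq p q * (1 + k ^+ 2) = 4 * r.
  rewrite sqr_sqrtr; last by rewrite subr_ge0 ler_pdivlMr ?mul1r //; lra.
  by field; apply: lt0r_neq0; lra.
pose o : plane R :=
  ((p.1 + q.1) / 2 - k * (q.2 - p.2) / 2, (p.2 + q.2) / 2 + k * (q.1 - p.1) / 2).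
have [z cz hz] := center_covers o c.
have far w : dsq o w = r -> z <> w by move=> hw e; move: hz; rewrite e hw; lra.
have op : dsq o p = r.
  transitivity (dsq p q * (1 + k ^+ 2) / 4); last by rewrite hk; field.
  by rewrite /dsq /o /=; field.
have oq : dsq o q = r.
  transitivity (dsq p q * (1 + k ^+ 2) / 4); last by rewrite hk; field.
  by rewrite /dsq /o /=; field.
exists z, k; split => //; first exact: sqrtr_ge0; last by rewrite dsqC.
by split; apply: (center_apart a) => //; apply: far.
Qed.

(** The center of the third tile is within 1 of the center of the circle and at
    distance at least sqrt 3 from [p] and [q]; this leaves room only if the arc cut
    by [p] and [q] is not too large. *)
Lemma circle_bound T p q (r : R) : apart T -> covers T -> center T p -> center T q ->
  p <> q -> dsq p q <= 4 * r -> 1 < r -> r < 2 -> (2 - r) ^+ 2 <= 4 * r - dsq p q.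
Proof.
move=> a c cp cq ne hr r1 r2.
have [z [k [_ k0 hk [zp zq] zo]]] := circle a c cp cq ne hr r1.
move: hk zp zq zo; rewrite /dsq /=.
have [u1 eu1] : exists u, u = (q.1 - p.1) / 2 by eexists.
have [u2 eu2] : exists u, u = (q.2 - p.2) / 2 by eexists.
have [w1 ew1] : exists w, w = z.1 - ((p.1 + q.1) / 2 - k * (q.2 - p.2) / 2) by eexists.
have [w2 ew2] : exists w, w = z.2 - ((p.2 + q.2) / 2 + k * (q.1 - p.1) / 2) by eexists.
rewrite -ew1 -ew2.
have -> : z.1 - p.1 = w1 + u1 - k * u2 by rewrite ew1 eu1 eu2; field.
have -> : z.2 - p.2 = w2 + u2 + k * u1 by rewrite ew2 eu1 eu2; field.
have -> : z.1 - q.1 = w1 - u1 - k * u2 by rewrite ew1 eu1 eu2; field.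
have -> : z.2 - q.2 = w2 - u2 + k * u1 by rewrite ew2 eu1 eu2; field.
have -> : p.1 - q.1 = - (2 * u1) by rewrite eu1; field.
have -> : p.2 - q.2 = - (2 * u2) by rewrite eu2; field.
clear eu1 eu2 ew1 ew2 hr ne cp cq a c => hk zp zq zo.
have [n en] : exists n, n = w2 * u1 - w1 * u2 by eexists.
have hk' : (u1 ^+ 2 + u2 ^+ 2) * (1 + k ^+ 2) = r.
  by apply: (@mulfI _ 4); rewrite // -hk; ring.
have h1 : 2 - r <= 2 * k * n.
  suff : 6 <= 2 * (w1 ^+ 2 + w2 ^+ 2) + 2 * ((u1 ^+ 2 + u2 ^+ 2) * (1 + k ^+ 2)) + 4 * k * n.
    by rewrite hk'; lra.
  by rewrite en; lra.
have h2 : n ^+ 2 <= u1 ^+ 2 + u2 ^+ 2.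
  have e : n ^+ 2 + (w1 * u1 + w2 * u2) ^+ 2 = (w1 ^+ 2 + w2 ^+ 2) * (u1 ^+ 2 + u2 ^+ 2).
    by rewrite en; ring.
  have := sqr_ge0 (w1 * u1 + w2 * u2); have := sqr_ge0 u1; have := sqr_ge0 u2.
  move: e zo; move: (n ^+ 2) (u1 ^+ 2) (u2 ^+ 2) (w1 ^+ 2 + w2 ^+ 2) (_ ^+ 2) => A B C D E.
  by nra.
have h3 : (2 - r) ^+ 2 <= (2 * k * n) ^+ 2 by rewrite ler_sqr ?nnegrE //; lra.
apply: le_trans h3 _.
have -> : 4 * r - ((- (2 * u1)) ^+ 2 + (- (2 * u2)) ^+ 2) = 4 * k ^+ 2 * (u1 ^+ 2 + u2 ^+ 2).
  by rewrite -hk'; ring.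
have -> : (2 * k * n) ^+ 2 = 4 * k ^+ 2 * n ^+ 2 by ring.
by apply: ler_wpM2l => //; apply: mulr_ge0 => //; apply: sqr_ge0.
Qed.

(** Let the radius tend to 1, or to half the distance when that is larger: the
    previous bound would fail for any squared distance strictly between 3 and 8. *)
Lemma center_distance T p q : apart T -> covers T -> center T p -> center T q ->
  p <> q -> dsq p q < 8 -> dsq p q = 3.
Proof.
move=> a c cp cq ne d8; have d3 := center_apart a cp cq ne.
apply/eqP; rewrite eq_le d3 andbT leNgt; apply/negP => lt3.
have key := circle_bound a c cp cq ne.
move: d3 d8 lt3 key; move: (dsq p q) => d d3 d8 lt3 key.
have [h|h] := ltrP d 4.
  (* Any radius close enough to the limit works; this one makes the bound fail by
   a margin that is linear in d - 3. *)
have := key (1 + (d - 3) / 16); rewrite expr2; nra.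
have := key (d / 4 + (8 - d) ^+ 2 / 128).
have [e ee] : exists e, e = 8 - d by eexists.
have -> : d = 8 - e by rewrite ee; ring.
have e0 : 0 < e by rewrite ee; lra.
have e4 : e <= 4 by rewrite ee; lra.
have ee0 : 0 < e * e by apply: mulr_gt0.
have ee4 : e * e <= 4 * e by apply: ler_wpM2r => //; apply: ltW.
rewrite !expr2 (_ : 8 - (8 - e) = e); last by ring.
have -> : (2 - ((8 - e) / 4 + e * e / 128)) * (2 - ((8 - e) / 4 + e * e / 128)) =
  e * e * ((1 / 4 - e / 128) * (1 / 4 - e / 128)) by field.
have f : 1 / 32 < (1 / 4 - e / 128) * (1 / 4 - e / 128) by nra.
move=> h'; have : e * e * ((1 / 4 - e / 128) * (1 / 4 - e / 128)) <=
  4 * ((8 - e) / 4 + e * e / 128) - (8 - e) by apply: h'; lra.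
have -> : 4 * ((8 - e) / 4 + e * e / 128) - (8 - e) = e * e * (1 / 32) by field.
by rewrite ler_pM2l // leNgt f.
Qed.

(** Two adjacent centers are completed to an equilateral triangle on their left.
    The third tile given by a circle of squared radius slightly above 1 is at
    distance less than 2 sqrt 2, hence exactly sqrt 3, from both. *)
Lemma apex T (a b a' b' : R) : apart T -> covers T -> center T (pt a b) ->
  center T (pt (a + a') (b + b')) -> sqn a' b' = 3 ->
  center T (pt (a - b') (b + a' + b')).
Proof.
move=> ap c cp cq h3.
have dpq : dsq (pt a b) (pt (a + a') (b + b')) = 3.
  by rewrite dsqE -h3 /sqn; ring.
have ne : pt a b <> pt (a + a') (b + b').
  by move=> e; move: dpq; rewrite e dsqxx; lra.
(* Any squared radius between 1 and 3 keeps the third center within 2 sqrt 2 of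
   both given ones. *)
have h4 : dsq (pt a b) (pt (a + a') (b + b')) <= 4 * (11 / 10) by rewrite dpq; lra.
have [|z [k [cz k0 hk [zp zq] zo]]] := circle ap c cp cq ne h4; first lra.
have [x0 [y0 ez]] := pt_surj z.
have [x ex] : exists x, x0 = a + x by exists (x0 - a); ring.
have [y ey] : exists y, y0 = b + y by exists (y0 - b); ring.
rewrite {}ex {}ey in ez.
set o := (X in dsq z X <= 1) in zo.
have near_o p : dsq o p = 11 / 10 -> dsq z p < 8.
  move=> op; apply: (@le_lt_trans _ _ (2 * dsq z o + 2 * dsq o p)); last by rewrite op; lra.
  have -> : 2 * dsq z o + 2 * dsq o p = dsq z p + ((z.1 + p.1 - 2 * o.1) ^+ 2 + (z.2 + p.2 - 2 * o.2) ^+ 2).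
    by rewrite /dsq; ring.
  by rewrite lerDl addr_ge0 // sqr_ge0.
have op : dsq o (pt a b) = 11 / 10.
  apply: (@mulfI _ 4) => //.
  by rewrite -[RHS]hk /dsq /o /=; field.
have oq : dsq o (pt (a + a') (b + b')) = 11 / 10.
  apply: (@mulfI _ 4) => //.
  by rewrite -[RHS]hk /dsq /o /=; field.
have zp3 : dsq z (pt a b) = 3.
  apply: (center_distance ap c) => //; last exact: near_o.
  by move=> e; move: zp; rewrite e dsqxx; lra.
have zq3 : dsq z (pt (a + a') (b + b')) = 3.
  apply: (center_distance ap c) => //; last exact: near_o.
  by move=> e; move: zq; rewrite e dsqxx; lra.
have side : 0 < a' * y - b' * x.
  have e1 : dsq z o = dsq z (pt a b) / 2 + dsq z (pt (a + a') (b + b')) / 2 -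
      dsq (pt a b) (pt (a + a') (b + b')) / 2 +
      dsq (pt a b) (pt (a + a') (b + b')) * (1 + k ^+ 2) / 4 - k * ht R * (a' * y - b' * x).
    by rewrite /dsq /o ez /pt /=; field.
  move: zo; rewrite e1 zp3 zq3 hk dpq => h.
  have : 0 < k * ht R * (a' * y - b' * x) by lra.
  have := mulr_ge0 k0 (ltW (ht_gt0 R)); move: (k * ht R) (_ - _) => A B; nra.
move: zp3 zq3; rewrite ez !dsqE.
have -> : a + x - a = x by ring.
have -> : b + y - b = y by ring.
have -> : a + x - (a + a') = x - a' by ring.
have -> : b + y - (b + b') = y - b' by ring.
rewrite /sqn in h3 * => q1 q2.
have c3 : a' * y - b' * x = 3.
  have : (a' * y - b' * x) ^+ 2 = 3 ^+ 2 by nra.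
  by move/eqP; rewrite eqf_sqr => /orP [/eqP|/eqP]; lra.
have b3 : 2 * x * a' + 2 * y * b' + x * b' + y * a' = 3 by lra.
have ex : x = - b'.
  have : 2 * x * (a' * a' + a' * b' + b' * b') = a' * 3 - (2 * b' + a') * 3.
    by rewrite -{1}b3 -c3; ring.
  by rewrite h3; lra.
have ey : y = a' + b'.
  have : 2 * y * (a' * a' + a' * b' + b' * b') = b' * 3 + (2 * a' + b') * 3.
    by rewrite -{1}b3 -c3; ring.
  by rewrite h3; lra.
by rewrite -addrA -ex -ey -ez.
Qed.
End Rigidity.

Section Lattice.
Variable R : realType.
Implicit Types (p q : plane R) (g t s : motion R) (T : set (motion R)).

(** * Tiles on the lattice *)

(** The center of the hexagon at [y], as an Eisenstein integer: the center of the
    neighbour across edge [i] is the sum of the vertices [i] and [i+1]. *)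
Definition site (y : pos) : pos := (y.1 - y.2, y.1 + y.2 + y.2).

Lemma siteD x y : site (x + y) = site x + site y.
Proof. by rewrite /site; plia. Qed.
Lemma site_dv i : site (dv i) = dv i + dv (nx i).
Proof. by case: i; rewrite /site; plia. Qed.
Lemma site_inj : injective site.
Proof. by move=> x y [] h1 h2; apply: posP; lia. Qed.

Lemma unit_dv i : (mpt R (dv i)).1 ^+ 2 + (mpt R (dv i)).2 ^+ 2 == 1.
Proof.
apply/eqP; transitivity (dsq (mpt R (dv i)) (pt 0 0)).
  by rewrite /dsq /pt /= !mul0r addr0 !subr0.
by rewrite dsqE /sqn; case: i => /=; ring.
Qed.

Definition std (y : pos) (D : deco) : motion R :=
  @Motion R (mpt R (site y)) (mpt R (dv D.1)) D.2 (unit_dv D.1).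

Lemma std_id : std 0 proto_deco = idm R.
Proof.
by apply: motion_eq => //=; rewrite /mpt /pt /=; congr (_, _); ring.
Qed.

(** Action on Eisenstein integers of the linear part of a copy. *)
Definition rotz (D : deco) (m : pos) : pos :=
  mulz (dv D.1) (if D.2 then conjz m else m).

Lemma act_std y D m : act (std y D) (mpt R m) = mpt R (site y + rotz D m).
Proof.
rewrite /act -mptD /rotz; cbn [shift turn mirror std].
by case: D.2; rewrite ?conj_mpt mul_mpt.
Qed.

(** Edge [j] of the prototile becomes edge [edir D j] of the copy: a reflection
    exchanges the endpoints of edges, hence the shift by one. *)
Definition edir (D : deco) (j : dir) : dir := if D.2 then subd D.1 (nx j) else addd D.1 j.
Definition compd (D D' : deco) : deco :=
  (if D.2 then subd D.1 D'.1 else addd D.1 D'.1, D.2 (+) D'.2).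

Lemma comp_std y D j D' :
  comp (std y D) (std (dv j) D') = std (y + dv (edir D j)) (compd D D').
Proof.
apply: motion_eq => //.
  rewrite [LHS](_ : _ = act (std y D) (mpt R (site (dv j)))) // act_std.
  rewrite [RHS](_ : _ = mpt R (site (y + dv (edir D j)))) // siteD; congr (mpt R (_ + _)).
  by case: D => [[] []]; case: j.
rewrite [LHS](_ : _ = mulp (mpt R (dv D.1))
   (if D.2 then conjp (mpt R (dv D'.1)) else mpt R (dv D'.1))) //.
rewrite [RHS](_ : _ = mpt R (dv (compd D D').1)) //.
have -> : (if D.2 then conjp (mpt R (dv D'.1)) else mpt R (dv D'.1)) =
    mpt R (if D.2 then conjz (dv D'.1) else dv D'.1).
  by case: D.2; rewrite ?conj_mpt.
rewrite mul_mpt; congr (mpt R _).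
by case: D => [[] []]; case: D' => [[] ?].
Qed.

Lemma comp_std_translate y x D : comp (std x proto_deco) (std y D) = std (x + y) D.
Proof.
apply: motion_eq => //.
  rewrite [LHS](_ : _ = act (std x proto_deco) (mpt R (site y))) // act_std.
  rewrite [RHS](_ : _ = mpt R (site (x + y))) // siteD; congr (mpt R (_ + _)).
  by rewrite /rotz /mulz /=; plia.
rewrite [LHS](_ : _ = mulp (mpt R (dv H0)) (mpt R (dv D.1))) // mul_mpt.
by congr (mpt R _); rewrite /mulz /=; plia.
Qed.

Lemma std_inj y D y' D' : std y D = std y' D' -> y = y' /\ D = D'.
Proof.
move=> e; split; first exact: site_inj (mpt_inj (congr1 (@shift R) e)).
have := congr1 (@mirror R) e; have := mpt_inj (congr1 (@turn R) e).
by case: D {e} => [[] m]; case: D' => [[] m'] //= _ ->.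
Qed.

(** The hexagon touches the unit circle at its vertices only. *)
Lemma unit_hex (a b : R) : hexR a b -> sqn a b = 1 -> exists i, (a, b) = ((dv i).1%:~R, (dv i).2%:~R).
Proof.
rewrite /sqn => -[/andP [a1 a2] /andP [b1 b2] /andP [c1 c2]] h.
have [ha|/ltW ha] := lerP 0 a; have [hb|/ltW hb] := lerP 0 b.
- have e : a * b = 0 by nra.
  move/eqP: e; rewrite mulf_eq0 => /orP [/eqP e|/eqP e].
    by exists H1; congr (_, _) => /=; nra.
  by exists H0; congr (_, _) => /=; nra.
- have [hc|/ltW hc] := lerP 0 (a + b).
    have e : (a + b) * b = 0 by nra.
    move/eqP: e; rewrite mulf_eq0 => /orP [/eqP e|/eqP e].
      by exists H5; congr (_, _) => /=; nra.
    by exists H0; congr (_, _) => /=; nra.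
  have e : (a + b) * a = 0 by nra.
  move/eqP: e; rewrite mulf_eq0 => /orP [/eqP e|/eqP e].
    by exists H5; congr (_, _) => /=; nra.
  by exists H4; congr (_, _) => /=; nra.
- have [hc|/ltW hc] := lerP 0 (a + b).
    have e : (a + b) * a = 0 by nra.
    move/eqP: e; rewrite mulf_eq0 => /orP [/eqP e|/eqP e].
      by exists H2; congr (_, _) => /=; nra.
    by exists H1; congr (_, _) => /=; nra.
  have e : (a + b) * b = 0 by nra.
  move/eqP: e; rewrite mulf_eq0 => /orP [/eqP e|/eqP e].
    by exists H2; congr (_, _) => /=; nra.
  by exists H3; congr (_, _) => /=; nra.
have e : a * b = 0 by nra.
move/eqP: e; rewrite mulf_eq0 => /orP [/eqP e|/eqP e].
  by exists H4; congr (_, _) => /=; nra.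
by exists H3; congr (_, _) => /=; nra.
Qed.

Lemma hexR_limit (a b : R) : (forall u : R, 0 < u -> u < 1 -> hexR (u * a) (u * b)) -> hexR a b.
Proof.
move=> h.
have lim (x : R) : (forall u : R, 0 < u -> u < 1 -> u * x <= 1) -> x <= 1.
  move=> hx; rewrite leNgt; apply/negP => x1.
  have x0 : 0 < x by lra.
  have := hx (2 / (1 + x)); rewrite mulrAC ler_pdivrMr ?ltr_pdivrMr ?divr_gt0 //; lra.
have b1 (x : R) : (forall u : R, 0 < u -> u < 1 -> -1 <= u * x <= 1) -> -1 <= x <= 1.
  move=> hx; rewrite lerNl; apply/andP; split; apply: lim => u u0 u1.
    by rewrite mulrN lerNl; have /andP [] := hx u u0 u1.
  by have /andP [] := hx u u0 u1.
split; apply: b1 => u u0 u1; have [] := h u u0 u1 => //.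
by rewrite -mulrDr.
Qed.
End Lattice.

Section Field.
Variable R : realType.
Implicit Types (p q : plane R) (g t s : motion R) (T : set (motion R)).

(** * From tilings to fields of tiles *)

(** The scalar product of [pt a b] and [pt c d]. *)
Definition dot (a b c d : R) : R := a * c + b * d + (a * d + b * c) / 2.

Lemma sqn_sub (a b c d : R) : sqn (a - c) (b - d) = sqn a b + sqn c d - 2 * dot a b c d.
Proof. by rewrite /sqn /dot; field. Qed.

Lemma dsq0 (a b : R) : dsq (pt 0 0) (pt a b) = sqn a b.
Proof. by rewrite dsqE /sqn; ring. Qed.

Lemma shift_idm : shift (idm R) = pt 0 0.
Proof. by rewrite /pt !mul0r addr0. Qed.

(** Let z be a center adjacent to the origin, and p the circumcenter of the
    triangle formed by the origin, z and its apex.  The points strictly between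
    the origin and p are covered by no other tile than the one at the origin, so p
    lies in its hexagon, at distance 1 from its center: it is a vertex, and this
    gives the direction of z. *)
Lemma first_neighbor T : apart T -> covers T -> T (idm R) ->
  exists j, center T (mpt R (site (dv j))).
Proof.
move=> ap c T0.
have c0 : center T (pt 0 0) by exists (idm R) => //; exact: shift_idm.
have near3 x y z : dsq z (pt 0 0) <= 2 -> dsq z (pt x y) <= 1 -> center T (pt x y) ->
    pt 0 0 <> pt x y -> sqn x y = 3.
  move=> h1 h2 cz ne; rewrite -dsq0; apply: (center_distance ap c) => //.
  have : dsq (pt 0 0) (pt x y) <= 2 * dsq z (pt 0 0) + 2 * dsq z (pt x y).
    have -> : 2 * dsq z (pt 0 0) + 2 * dsq z (pt x y) = dsq (pt 0 0) (pt x y) +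
       (((pt 0 0).1 + (pt x y).1 - 2 * z.1) ^+ 2 + ((pt 0 0).2 + (pt x y).2 - 2 * z.2) ^+ 2).
      by rewrite /dsq; ring.
    by rewrite lerDl addr_ge0 // sqr_ge0.
  lra.
have [z] := center_covers (pt (11 / 10) 0) c; have [a [b ->]] := pt_surj z => cz hz.
have q3 : sqn a b = 3.
  apply: (near3 _ _ (pt (11 / 10) 0)) => //.
    by rewrite dsqE /sqn; lra.
  by move=> e; move: hz; rewrite -e dsqE /sqn; lra.
have cz1 : center T (pt (- b) (a + b)).
  have := @apex R T 0 0 a b ap c; rewrite !add0r; apply => //.
pose al := (a - b) / 3; pose be := (a + b + b) / 3.
have hq : sqn al be = 1.
  have -> : sqn al be = sqn a b / 3 by rewrite /al /be /sqn; field.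
  by rewrite q3; field.
have hp : hexR al be.
  apply: hexR_limit => u u0 u1.
  have [t Tt bt] := c (pt (u * al) (u * be)).
  have [e|ne] := pselect (t = idm R).
    by move: bt; rewrite e => -[q + e']; rewrite act_id in e'; rewrite e' => /hexagonE.
  exfalso; have ht := body_dsq bt; have ct : center T (shift t) by exists t.
  have far := ap _ _ Tt T0 ne; move: ct ht far; have [x [y ->]] := pt_surj (shift t).
  move=> ct ht far; rewrite shift_idm dsqC dsq0 in far.
  have nz : pt 0 0 <> pt x y by move=> e; move: far; rewrite -dsq0 -e dsqxx; lra.
  have Qu : sqn (u * al) (u * be) = u * u by rewrite -[RHS]mulr1 -hq /sqn; ring.
  have xy3 : sqn x y = 3.
    apply: (near3 _ _ (pt (u * al) (u * be))) => //.
    by rewrite dsqC dsq0 Qu; nra.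
  rewrite dsqE sqn_sub Qu xy3 in ht.
  have du : dot (u * al) (u * be) x y = u * dot al be x y by rewrite /dot; field.
  rewrite du in ht.
  (* A third center x covering u p would make an angle of less than 30 degrees with
   p, hence be too close to one of the two centers adjacent to p. *)
have d32 : 3 / 2 < dot al be x y.
    rewrite ltNge; apply/negP => hle; nra.
  have ds : 3 * dot al be x y = dot x y a b + dot x y (- b) (a + b).
    by rewrite /dot /al /be; field.
  have q31 : sqn (- b) (a + b) = 3 by rewrite -q3 /sqn; ring.
  have close (a' b' : R) : center T (pt a' b') -> sqn a' b' = 3 -> dot al be a' b' = 3 / 2 ->
      9 / 4 < dot x y a' b' -> False.
    move=> c' q' d' h; have e : pt x y = pt a' b'.
      by apply: (center_near ap) => //; rewrite dsqE sqn_sub xy3 q'; lra.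
    by move: e => /pt_inj [e1 e2]; move: d32; rewrite e1 e2 d'; lra.
  have [h|h] := ltrP (9 / 4) (dot x y a b).
    apply: (close a b) => //.
    have -> : dot al be a b = sqn a b / 2 by rewrite /dot /al /be /sqn; field.
    by rewrite q3.
  apply: (close (- b) (a + b)) => //; last by lra.
  have -> : dot al be (- b) (a + b) = sqn a b / 2 by rewrite /dot /al /be /sqn; field.
  by rewrite q3.
have [i [e1 e2]] := unit_hex hp hq.
exists (pv i); rewrite site_dv /mpt.
have ea : a = 2 * al + be by rewrite /al /be; field.
have eb : b = be - al by rewrite /al /be; field.
move: cz; rewrite ea eb e1 e2; congr (center T (pt _ _)).
  by case: i {e1 e2} => /=; rewrite ?add1 /=; ring.
by case: i {e1 e2} => /=; rewrite ?add2 /=; ring.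
Qed.

Lemma neighbors T j : apart T -> covers T -> T (idm R) -> center T (mpt R (site (dv j))).
Proof.
move=> ap c T0; have [i hi] := first_neighbor ap c T0.
have c0 : center T (pt 0 0) by exists (idm R) => //; exact: shift_idm.
have step k : center T (mpt R (site (dv k))) -> center T (mpt R (site (dv (nx k)))).
  move=> ck; have := @apex R T 0 0 (site (dv k)).1%:~R (site (dv k)).2%:~R ap c c0.
  rewrite !add0r => /(_ ck).
  have -> : sqn ((site (dv k)).1%:~R : R) (site (dv k)).2%:~R = 3.
    by rewrite /sqn; case: k {ck} => /=; ring.
  move=> /(_ erefl); rewrite /mpt; congr (center T (pt _ _)); case: k {ck} => /=; ring.
have : forall n, center T (mpt R (site (dv (iter n nx i)))).
  by elim=> // n; apply: step.
move=> /(_ (dir_nat (subd j i))); congr (center T (mpt R (site (dv _)))).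
by case: i {hi}; case: j.
Qed.

(** The origin is adjacent to the center of the neighbouring tile, hence is one of
    the six sites around it in the frame of that tile: this leaves six turns. *)
Lemma neighbor_std T j : apart T -> covers T -> T (idm R) ->
  exists D, T (std R (dv j) D).
Proof.
move=> ap c T0; have [s Ts es] := neighbors j ap c T0.
pose T' := pull s T.
have ap' : apart T' by exact: pull_apart.
have c' : covers T' by exact: pull_covers.
have T0' : T' (idm R).
  rewrite /T' /pull /=; have [h eh] := comp_surj s s.
  suff e : comp s (idm R) = s by rewrite e.
  apply: motion_eq => /=; last by rewrite addbF.
    by rewrite act0.
  by rewrite /comp_turn /mulp /conjp /=; case: (mirror s); case: (turn s) => x y /=; congr (_, _); ring.
have [h eh] := comp_surj s (idm R).
have Th : T' h by rewrite /T' /pull /= eh.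
have [x [y exy]] := pt_surj (shift h).
have ch : center T' (pt x y) by exists h.
have Qh : sqn x y = 3.
  rewrite -dsq0 -exy -shift_idm -(dsq_act s) -[act s (shift h)]/(shift (comp s h)) eh.
  rewrite [act s _](_ : _ = shift s); last exact: act0.
  by rewrite es shift_idm dsqC dsq0 /mpt /sqn; case: (j) => /=; ring.
have [k ek] : exists k, pt x y = mpt R (site (dv k)).
  apply: contrapT => nk.
  have far k : dot x y (site (dv k)).1%:~R (site (dv k)).2%:~R <= 3 / 2.
    have ne : pt x y <> mpt R (site (dv k)) by move=> e; apply: nk; exists k.
    have := center_apart ap' ch (neighbors k ap' c' T0') ne.
    rewrite /mpt dsqE sqn_sub Qh.
    have -> : sqn ((site (dv k)).1%:~R : R) (site (dv k)).2%:~R = 3.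
      by rewrite /sqn; case: k {ne} => /=; ring.
    by lra.
  have : hexR x y.
    have := far H0; have := far H1; have := far H2; have := far H3; have := far H4.
    have := far H5; rewrite /dot /= => *.
    by split; apply/andP; split; lra.
  by move/hexR_sqn; rewrite Qh; lra.
have e0 : act s (mpt R (site (dv k))) = (0, 0).
  by rewrite -ek -exy -[act s (shift h)]/(shift (comp s h)) eh.
have [i ei] : exists i, turn s = mpt R (dv i).
  have [u [v euv]] := pt_surj (turn s).
  move: e0; rewrite /act es euv.
  have -> : (if mirror s then conjp (mpt R (site (dv k))) else mpt R (site (dv k))) =
    mpt R (if mirror s then conjz (site (dv k)) else site (dv k)) by case: (mirror s); rewrite ?conj_mpt.
  have [k' ->] : exists k', (if mirror s then conjz (site (dv k)) else site (dv k)) = site (dv k').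
    case: (mirror s); last by exists k.
    by exists (subd H0 (nx k)); case: (k).
  rewrite [mpt R (site (dv k'))]/mpt mul_pt.
  have ptD (a b a' b' : R) : ((pt a b).1 + (pt a' b').1, (pt a b).2 + (pt a' b').2) = pt (a + a') (b + b').
    by rewrite /pt /=; congr (_, _); field.
  rewrite ptD -[(0, 0)]/(shift (idm R)) shift_idm => /pt_inj [e1 e2].
  exists (subd (opp j) k'); rewrite /mpt; congr pt; move: e1 e2; clear.
    by case: j; case: k' => /= e1 e2; lra.
  by case: j; case: k' => /= e1 e2; lra.
exists (i, mirror s); suff <- : s = std R (dv j) (i, mirror s) by [].
by apply: motion_eq.
Qed.

End Field.

Section FieldOfTiles.
Variable R : realType.
Implicit Types (p q : plane R) (g t s : motion R) (T : set (motion R)) (F : pos -> deco).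

(** The tiles of a decoration, and the image of a set of tiles under a motion. *)
Definition field_of F : set (motion R) := [set t | exists y, t = std R y (F y)].
Definition moved g T : set (motion R) := [set comp g t | t in T].

(** Round down both coordinates on the lattice of centers, then choose the corner
    of the unit cell whose hexagon contains the point. *)
Lemma nearest_center (a b : R) : exists y : pos,
  hexR (a - (site y).1%:~R) (b - (site y).2%:~R).
Proof.
have floorE (x : R) : exists (n : int) r, [/\ x = n%:~R + r, 0 <= r & r < 1].
  exists (Num.floor x), (x - (Num.floor x)%:~R); split; first by ring.
    by rewrite subr_ge0 ge_floor.
  by have := floorD1_gt x; rewrite intrD; lra.
have [m [s [es s0 s1]]] := floorE ((2 * a + b) / 3).
have [n [t [et t0 t1]]] := floorE ((b - a) / 3).
have ea : a = m%:~R - n%:~R + s - t by lra.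
have eb : b = m%:~R + 2 * n%:~R + s + 2 * t by lra.
have corner (i j : int) : -1 <= (s - i%:~R) - (t - j%:~R) <= 1 ->
    -1 <= (s - i%:~R) + 2 * (t - j%:~R) <= 1 -> -1 <= 2 * (s - i%:~R) + (t - j%:~R) <= 1 ->
    exists y : pos, hexR (a - (site y).1%:~R) (b - (site y).2%:~R).
  move=> /andP [a1 a2] /andP [b1 b2] /andP [c1 c2].
  exists (m + i, n + j); rewrite /site /= !intrD !mulrNz !intrD ea eb.
  by split; apply/andP; split; lra.
have [h|/ltW h] := lerP t s.
  have [h1|/ltW h1] := lerP (2 * s + t) 1.
    by apply: (corner 0 0); apply/andP; split; lra.
  have [h2|/ltW h2] := lerP (s + 2 * t) 2.
    by apply: (corner 1 0); apply/andP; split; lra.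
  by apply: (corner 1 1); apply/andP; split; lra.
have [h1|/ltW h1] := lerP (s + 2 * t) 1.
  by apply: (corner 0 0); apply/andP; split; lra.
have [h2|/ltW h2] := lerP (2 * s + t) 2.
  by apply: (corner 0 1); apply/andP; split; lra.
by apply: (corner 1 1); apply/andP; split; lra.
Qed.

Lemma pos_ind (P : pos -> Prop) : P 0 -> (forall y i, P y -> P (y + dv i)) -> forall y, P y.
Proof.
move=> P0 st [a b].
have row (n : nat) y i : P y -> P (y + dv i *+ n).
  by move=> Py; elim: n => [|n IH]; rewrite ?mulr0n ?addr0 // mulrSr addrA; apply: st.
have e (i : dir) n : dv i *+ n = ((dv i).1 *+ n, (dv i).2 *+ n).
  by elim: n => [|n IH]; rewrite ?mulr0n // !mulrSr IH.
have line (m : int) y : P y -> P (y + (m, 0)) /\ P (y + (0, m)).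
  move=> Py; case: m => n.
    split; [have := row n y H0 Py | have := row n y H1 Py]; congr (P (_ + _));
      rewrite e; congr (_, _) => /=; rewrite ?mul0rn //; lia.
  split; [have := row n.+1 y H3 Py | have := row n.+1 y H4 Py]; congr (P (_ + _));
    rewrite e; congr (_, _) => /=; rewrite ?mul0rn // NegzE; lia.
have [+ _] := line a 0 P0; rewrite add0r => /(line b) [_].
by congr P; plia.
Qed.

Lemma comp_id g : comp g (idm R) = g.
Proof.
apply: motion_eq => /=; last by rewrite addbF.
  exact: act0.
rewrite /comp_turn /mulp /conjp /=.
by case: (mirror g); case: (turn g) => x y /=; congr (_, _); ring.
Qed.

(** Propagate from [t0] to all sites through adjacent tiles; a tile that would be
    elsewhere would be too close to the nearest site. *)
Lemma tiling_field T t0 : apart T -> covers T -> T t0 ->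
  exists F, F 0 = proto_deco /\ T = moved t0 (field_of F).
Proof.
move=> ap c Tt0.
have all_std : forall y, exists D, T (comp t0 (std R y D)).
  apply: pos_ind => [|y i [D TD]].
    by exists proto_deco; rewrite std_id comp_id.
  pose s := comp t0 (std R y D); pose T' := pull s T.
  have T'0 : T' (idm R) by rewrite /T' /pull /= comp_id.
  have [j ej] : exists j, edir D j = i.
    by case: D {TD s T' T'0} => [k []]; rewrite /edir /=;
      [exists (subd k (nx i)) | exists (subd i k)]; case: k; case: i.
  have ap' : apart T' by exact: pull_apart.
  have c' : covers T' by exact: pull_covers.
  have [D' TD'] := neighbor_std j ap' c' T'0.
  exists (compd D D'); rewrite -ej -comp_std -compA; exact: TD'.
have [F hF] := choice all_std.
have uniq s s' : T (comp t0 s) -> T (comp t0 s') -> dsq (shift s) (shift s') < 3 -> s = s'.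
  move=> Ts Ts' h; apply: contrapT => ne.
  have ap' : apart (pull t0 T) by exact: pull_apart.
  by have := ap' _ _ Ts Ts' ne; lra.
exists F; split.
  have e : std R 0 (F 0) = std R 0 proto_deco.
    by apply: uniq; [exact: hF | rewrite std_id comp_id | rewrite /= dsqxx].
  by have [] := std_inj e.
apply/seteqP; split => [t Tt|_ [s [y ->] <-]]; last exact: hF.
have [s es] := comp_surj t0 t; exists s => //.
have [a [b e]] := pt_surj (shift s); have [y hy] := nearest_center a b.
exists y; apply: uniq => //; first by rewrite es.
rewrite e /= /mpt dsqE; have := hexR_sqn hy; lra.
Qed.

Lemma std_body y D (a b : R) :
  body (std R y D) (pt a b) <-> hexR (a - (site y).1%:~R) (b - (site y).2%:~R).
Proof.
have actE u v : act (std R y D) (pt u v) =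
    let w := if D.2 then (u + v, - v) else (u, v) in
    let k := dv D.1 in
    pt ((site y).1%:~R + (k.1%:~R * w.1 - k.2%:~R * w.2))
       ((site y).2%:~R + (k.1%:~R * w.2 + k.2%:~R * w.1 + k.2%:~R * w.2)).
  rewrite /act; cbn [shift turn mirror std].
  by case: D.2; rewrite ?conj_pt /mpt mul_pt /pt /=; congr (_, _); field.
split.
  case=> q; have [u [v ->]] := pt_surj q => /hexagonE [/andP [? ?] /andP [? ?] /andP [? ?]].
  rewrite actE => /pt_inj [<- <-]; move: (site y) => m.
  by case: D {actE} => [[] []] /=; split; apply/andP; split; lra.
set x := a - _; set z := b - _ => -[/andP [? ?] /andP [? ?] /andP [? ?]].
have ea : a = (site y).1%:~R + x by rewrite /x; ring.
have eb : b = (site y).2%:~R + z by rewrite /z; ring.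
suff [u [v [h e1 e2]]] : exists u v, [/\ hexR u v,
    (let w := if D.2 then (u + v, - v) else (u, v) in let k := dv D.1 in
      k.1%:~R * w.1 - k.2%:~R * w.2) = x &
    (let w := if D.2 then (u + v, - v) else (u, v) in let k := dv D.1 in
      k.1%:~R * w.2 + k.2%:~R * w.1 + k.2%:~R * w.2) = z].
  exists (pt u v); first exact/hexagonE.
  by rewrite actE; move: e1 e2 => /= -> ->; rewrite -ea -eb.
pose k := dv (subd H0 D.1).
pose u := k.1%:~R * x - k.2%:~R * z; pose v := k.1%:~R * z + k.2%:~R * x + k.2%:~R * z.
exists (if D.2 then u + v else u), (if D.2 then - v else v).
rewrite /u /v /k; clearbody x z; clear ea eb actE.
by case: D {u v k} => [[] []] /=; (split; [split; apply/andP; split; lra | ring | ring]).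
Qed.

(** Strict inequalities in the interior, by moving slightly along the axes. *)
Lemma std_interior y D (a b : R) : interior (body (std R y D)) (pt a b) ->
  let u := a - (site y).1%:~R in let v := b - (site y).2%:~R in
  [/\ -1 < u < 1, -1 < v < 1 & -1 < u + v < 1].
Proof.
move=> hint u v; have [e e0 he] := (iffLR (nbhs_ballP _ _) hint); rewrite /= in e0.
have inb (x z : R) : - (e / 2) <= x <= e / 2 -> - (e / 2) <= z <= e / 2 ->
    hexR (u + x) (v + z).
  move=> hx hz.
  have : body (std R y D) (pt (a + x) (b + z)).
    apply: he; have h0 := ht_gt0 R; have h1 := ht_lt1 R.
    move: hx hz => /andP [x1 x2] /andP [z1 z2].
    have z3 : - (e / 2) <= z * ht R by nra.
    have z4 : z * ht R <= e / 2 by nra.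
    split; rewrite /ball /= ltr_norml; apply/andP; split; lra.
  move/std_body; rewrite /u /v.
  by congr hexR; ring.
have e2 : - (e / 2) <= e / 2 <= e / 2 by apply/andP; split; lra.
have e2' : - (e / 2) <= - (e / 2) <= e / 2 by apply/andP; split; lra.
have z0 : - (e / 2) <= 0 <= e / 2 by apply/andP; split; lra.
have [/andP [? ?] /andP [? ?] /andP [? ?]] := inb _ _ e2 z0.
have [/andP [? ?] /andP [? ?] /andP [? ?]] := inb _ _ e2' z0.
have [/andP [? ?] /andP [? ?] /andP [? ?]] := inb _ _ z0 e2.
have [/andP [? ?] /andP [? ?] /andP [? ?]] := inb _ _ z0 e2'.
by split; apply/andP; split; lra.
Qed.

Lemma field_tiling F : tiling (field_of F).
Proof.
split=> [p|t t' [y ->] [y' ->] ne].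
  have [a [b ->]] := pt_surj p; have [y hy] := nearest_center a b.
  by exists (std R y (F y)); [exists y | apply/std_body].
rewrite -subset0 => p; have [a [b ->]] := pt_surj p => -[/std_interior h /std_interior h'].
apply: ne; suff -> : y = y' by [].
move: h h' => [/andP [? ?] /andP [? ?] /andP [? ?]] [/andP [? ?] /andP [? ?] /andP [? ?]].
have lt2 (m n : int) : (m%:~R - n%:~R : R) < 2 -> m - n < 2.
  by rewrite -(ltr_int R) intrB.
apply: site_inj; have := lt2 (site y).1 (site y').1; have := lt2 (site y').1 (site y).1.
have := lt2 (site y).2 (site y').2; have := lt2 (site y').2 (site y).2.
have := lt2 ((site y).1 + (site y).2) ((site y').1 + (site y').2).
have := lt2 ((site y').1 + (site y').2) ((site y).1 + (site y).2).
have i1 := intrD R (site y).1 (site y).2; have i2 := intrD R (site y').1 (site y').2.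
rewrite i1 i2 => k1 k2 k3 k4 k5 k6.
have {}k1 := k1 ltac:(lra); have {}k2 := k2 ltac:(lra); have {}k3 := k3 ltac:(lra).
have {}k4 := k4 ltac:(lra); have {}k5 := k5 ltac:(lra); have {}k6 := k6 ltac:(lra).
by move: k1 k2 k3 k4 k5 k6; clear; rewrite /site /= => *; apply: posP => /=; lia.
Qed.
End FieldOfTiles.

Section Rules.
Variable R : realType.
Implicit Types (p q : plane R) (g t s : motion R) (T : set (motion R)) (F : pos -> deco).

(** * The matching rules on a field of tiles *)

(** The absolute direction of vertex [i] of the prototile in a copy, and the
    prototile index of the edge of a copy in a given absolute direction. *)
Definition vdir (D : deco) (i : dir) : dir := if D.2 then subd D.1 i else addd D.1 i.
Definition edge_index (D : deco) (e : dir) : dir := if D.2 then subd D.1 (nx e) else subd e D.1.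

Lemma vertex_std y D k : vertex (std R y D) k = mpt R (site y + dv (vdir D (dirz k))).
Proof.
rewrite /vertex proto_vertexE act_std; congr (mpt R (_ + _)).
by case: D => [[] []]; case: (dirz k).
Qed.

Lemma red_std y D k : red (std R y D) k = red_deco D (vdir D (dirz k)).
Proof.
rewrite -[k]dirzK zdirK; case: D => [[] []]; case: (dirz k); reflexivity.
Qed.

Lemma edge_std y D e : edge (std R y D) (zdir (edge_index D e)) =
  [set mpt R (site y + dv e); mpt R (site y + dv (nx e))].
Proof.
rewrite /edge !vertex_std dirzS zdirK.
have [[-> ->]|[-> ->]] : (vdir D (edge_index D e) = e /\ vdir D (nx (edge_index D e)) = nx e) \/
    (vdir D (edge_index D e) = nx e /\ vdir D (nx (edge_index D e)) = e).
  by case: D => [[] []]; case: e; auto.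
- by [].
by rewrite setUC.
Qed.

Lemma stripe_std y D e : stripe_point (std R y D) (zdir (edge_index D e)) =
  if first_end D e
  then (3 / 4) *: mpt R (site y + dv e) + (1 / 4) *: mpt R (site y + dv (nx e))
  else (3 / 4) *: mpt R (site y + dv (nx e)) + (1 / 4) *: mpt R (site y + dv e).
Proof.
rewrite /stripe_point !vertex_std.
set nr := proto_near _; set fr := if _ then _ else _.
have [-> ->] : vdir D (dirz nr) = (if first_end D e then e else nx e) /\
    vdir D (dirz fr) = (if first_end D e then nx e else e).
  by rewrite {}/fr {}/nr; case: D => [[] []]; case: e.
by case: first_end.
Qed.

Lemma edge_indexP D k : exists e, k = zdir (edge_index D e).
Proof.
exists (if D.2 then subd D.1 (nx (dirz k)) else addd D.1 (dirz k)).
rewrite -[LHS]dirzK; congr zdir.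
by case: D => [[] []]; case: (dirz k).
Qed.

Lemma set2_eq (A : Type) (a b c d : A) : [set a; b] = [set c; d] ->
  a <> b -> (a = c /\ b = d) \/ (a = d /\ b = c).
Proof.
move=> e ne.
have : [set c; d] a by rewrite -e; left.
have : [set c; d] b by rewrite -e; right.
by case=> hb; case=> ha; [case: ne; rewrite ha hb | right | left | case: ne; rewrite ha hb].
Qed.

Lemma dv_nx_neq i : dv i <> dv (nx i). Proof. by case: i. Qed.

Lemma edge_neq y e : mpt R (site y + dv e) <> mpt R (site y + dv (nx e)).
Proof. by move=> /mpt_inj /addrI; exact: dv_nx_neq. Qed.

Lemma edge_std_eq y D k y' D' k' : edge (std R y D) k = edge (std R y' D') k' ->
  exists e, k = zdir (edge_index D e) /\
    ((y' = y /\ k' = zdir (edge_index D' e)) \/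
     (y' = y + dv e /\ k' = zdir (edge_index D' (opp e)))).
Proof.
have [e ->] := edge_indexP D k; have [f ->] := edge_indexP D' k'.
rewrite !edge_std => ee; have h := set2_eq ee (@edge_neq _ _).
clear ee; exists e; split => //.
case: h => [[/mpt_inj h1 /mpt_inj h2]|[/mpt_inj h1 /mpt_inj h2]].
  left; have ef : e = f.
    by move: h1 h2 => [a1 a2] [b1 b2]; move: a1 a2 b1 b2; case: e; case: f => //=; lia.
  by split; [apply: site_inj; apply: (@addIr _ (dv e)); rewrite {1}ef | rewrite ef].
right; have ef : f = opp e.
  by move: h1 h2 => [a1 a2] [b1 b2]; move: a1 a2 b1 b2; case: e; case: f => //=; lia.
split; last by rewrite ef.
apply: site_inj; rewrite siteD site_dv.
by move: h1; rewrite ef; case: (e) => h; apply: posP; move: (congr1 fst h) (congr1 snd h);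
  rewrite /= => ? ?; split; lia.
Qed.

Lemma stripe_neq (a b : plane R) : a <> b -> (3 / 4) *: a + (1 / 4) *: b <> (3 / 4) *: b + (1 / 4) *: a.
Proof.
move=> ne e; apply: ne; move: a b e => [a1 a2] [b1 b2] [].
rewrite /GRing.scale /= /GRing.scale /= => e1 e2.
by congr (_, _); lra.
Qed.

Lemma legal_deco_R1 F : legal_deco F -> R1 (@field_of R F).
Proof.
move=> lF _ _ k k' [y ->] [y' ->] /edge_std_eq [e [-> [[-> ->]|[ey ->]]]] //.
rewrite !stripe_std; have := (lF y e).1; rewrite /edge_ok -ey.
have -> : mpt R (site y' + dv (opp e)) = mpt R (site y + dv (nx e)).
  by rewrite ey siteD site_dv dv_opp; congr (mpt R _); plia.
have -> : mpt R (site y' + dv (nx (opp e))) = mpt R (site y + dv e).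
  have -> : nx (opp e) = opp (nx e) by case: (e).
  by rewrite ey siteD site_dv dv_opp; congr (mpt R _); plia.
by case: first_end; case: first_end.
Qed.

Lemma R1_edge_ok F y i : R1 (@field_of R F) -> edge_ok i (F y) (F (y + dv i)).
Proof.
move=> r1; have := r1 (std R y (F y)) (std R (y + dv i) (F (y + dv i)))
  (zdir (edge_index (F y) i)) (zdir (edge_index (F (y + dv i)) (opp i))).
have e1 : mpt R (site (y + dv i) + dv (opp i)) = mpt R (site y + dv (nx i)).
  by rewrite siteD site_dv dv_opp; congr (mpt R _); plia.
have e2 : mpt R (site (y + dv i) + dv (nx (opp i))) = mpt R (site y + dv i).
  have -> : nx (opp i) = opp (nx i) by case: (i).
  by rewrite siteD site_dv dv_opp; congr (mpt R _); plia.
rewrite !edge_std !stripe_std e1 e2 setUC => h.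
have {h} := h (ex_intro _ y erefl) (ex_intro _ _ erefl) erefl; rewrite /edge_ok.
case: first_end; case: first_end => // /esym h; exfalso.
  exact: (stripe_neq (@edge_neq y i)).
by apply: (stripe_neq (@edge_neq y i)).
Qed.

Lemma has_edge_std y D p q : has_edge (std R y D) p q <->
  exists e, [set p; q] = [set mpt R (site y + dv e); mpt R (site y + dv (nx e))].
Proof.
split=> [[k]|[e ee]].
  by have [e ->] := edge_indexP D k; rewrite edge_std => <-; exists e.
by exists (zdir (edge_index D e)); rewrite edge_std.
Qed.

Lemma R2_diam_ok F y i : R2 (@field_of R F) -> diam_ok i (F y) (F (y + wv i)).
Proof.
move=> r2.
have vk z D j : exists k, vdir D (dirz k) = j /\ vertex (std R z D) k = mpt R (site z + dv j).
  exists (zdir (if D.2 then subd D.1 j else subd j D.1)); rewrite vertex_std zdirK.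
  suff e : vdir D (if D.2 then subd D.1 j else subd j D.1) = j by rewrite e.
  by case: D => [[] []]; case: j.
have [k [ek vk1]] := vk y (F y) i.
have [l [el vl]] := vk (y + wv i) (F (y + wv i)) (opp i).
have := r2 (std R (y + dv i) (F (y + dv i))) _ _ k l (ex_intro _ _ erefl)
  (ex_intro _ y erefl) (ex_intro _ (y + wv i) erefl).
rewrite vk1 vl !red_std ek el /diam_ok => h; apply/eqP; apply: h.
- apply/has_edge_std; exists (opp (nx i)); congr [set mpt R _; mpt R _].
    by rewrite !siteD; case: (i); rewrite /site /wv; plia.
  by rewrite !siteD; case: (i); rewrite /site /wv; plia.
- move=> /has_edge_std [e ee].
  have : [set mpt R (site y + dv e); mpt R (site y + dv (nx e))]
      (mpt R (site (y + wv i) + dv (opp i))) by rewrite -ee; right.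
  rewrite siteD => -[] /mpt_inj; rewrite -addrA => /addrI [].
    by case: (i); case: (e); vm_compute.
  by case: (i); case: (e); vm_compute.
move=> /has_edge_std [e ee].
have : [set mpt R (site (y + wv i) + dv e); mpt R (site (y + wv i) + dv (nx e))]
    (mpt R (site y + dv i)) by rewrite -ee; left.
rewrite siteD => -[] /mpt_inj; rewrite -addrA => /addrI [].
  by case: (i); case: (e); vm_compute.
by case: (i); case: (e); vm_compute.
Qed.

(** A vertex belongs to exactly three hexagons. *)
Lemma vertex_at (y z : pos) (a b : dir) : site y + dv a = site z + dv b ->
  [\/ z = y, z = y + dv a /\ b = nx (nx (nx (nx a))) | z = y + dv (pv a) /\ b = nx (nx a)].
Proof.
move=> h; move: (congr1 fst h) (congr1 snd h) => {h}.
rewrite /site !add1 !add2 /= => h1 h2.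
have e : b = a \/ b = nx (nx (nx (nx a))) \/ b = nx (nx a).
  by move: h1 h2; case: a; case: b => /= h1 h2; auto; exfalso; lia.
case: e => [e|[e|e]].
- by apply: Or31; apply: posP; move: h1 h2; rewrite e; lia.
- apply: Or32; split => //; apply: posP; rewrite add1 add2; move: h1 h2; rewrite {}e.
  by case: a => /= h1 h2; lia.
apply: Or33; split => //; apply: posP; rewrite add1 add2; move: h1 h2; rewrite {}e.
by case: a => /= h1 h2; lia.
Qed.

Lemma legal_deco_R2 F : legal_deco F -> R2 (@field_of R F).
Proof.
move=> lF _ _ _ k l [y ->] [yp ->] [yq ->] p q he hp hq.
rewrite !red_std; move: hp hq he; rewrite /p /q !vertex_std => {p q}.
move: (vdir _ (dirz k)) (vdir _ (dirz l)) => a b hp hq /has_edge_std [e ee].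
(* A tile that contains an endpoint of edge e of y but not the edge is the third
   tile around that endpoint. *)
have third z (c f : dir) (D : deco) : mpt R (site z + dv c) = mpt R (site y + dv f) ->
    ~ has_edge (std R z D) (mpt R (site y + dv e)) (mpt R (site y + dv (nx e))) ->
    (f = e -> z = y + dv (pv e) /\ c = nx (nx e)) /\
    (f = nx e -> z = y + dv (nx e) /\ c = pv e).
  move=> /mpt_inj /esym h ne.
  have ny : z <> y by move=> ey; apply: ne; apply/has_edge_std; exists e; rewrite ey.
  have nz : z <> y + dv e.
    move=> ez; apply: ne; apply/has_edge_std; exists (opp e); rewrite ez setUC.
    congr [set mpt R _; mpt R _]; rewrite siteD site_dv.
      by rewrite dv_opp; plia.
    by case: (e) => /=; plia.
  case: (vertex_at h) => [ez|[ez ->]|[ez ->]]; first by case: ny.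
    split=> ef; rewrite ef in ez; first by case: nz.
    by split => //; rewrite ef; case: (e).
  split=> ef; rewrite ef in ez *; first by [].
  by case: nz; rewrite ez; congr (y + dv _); case: (e).
have ne := @edge_neq y e.
have nab : mpt R (site yp + dv a) <> mpt R (site yq + dv b).
  move=> h; apply: ne; rewrite h in ee.
  have : [set mpt R (site yq + dv b); mpt R (site yq + dv b)] (mpt R (site y + dv e)).
    by rewrite ee; left.
  have : [set mpt R (site yq + dv b); mpt R (site yq + dv b)] (mpt R (site y + dv (nx e))).
    by rewrite ee; right.
  by move=> [->|->] [->|->].
have o2 : diam_ok (nx (nx e)) (F (y + dv (pv e))) (F (y + dv (nx e))).
  have := (lF (y + dv (pv e)) (nx (nx e))).2.
  by congr (diam_ok _ _ (F _)); case: (e); plia.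
have opp2 : opp (nx (nx e)) = pv e by case: (e).
rewrite /diam_ok opp2 in o2.
have [[h1 h2]|[h1 h2]] := set2_eq ee nab; rewrite h1 h2 in hp hq.
  have [/(_ erefl) [-> ->] _] := third _ _ _ _ h1 hp.
  have [_ /(_ erefl) [-> ->]] := third _ _ _ _ h2 hq.
  exact/eqP.
have sw z D : has_edge (std R z D) (mpt R (site y + dv e)) (mpt R (site y + dv (nx e))) ->
    has_edge (std R z D) (mpt R (site y + dv (nx e))) (mpt R (site y + dv e)).
  by move=> [i ei]; exists i; rewrite setUC.
have [_ /(_ erefl) [-> ->]] := third _ _ _ _ h1 (fun h => hp (sw _ _ h)).
have [/(_ erefl) [-> ->] _] := third _ _ _ _ h2 (fun h => hq (sw _ _ h)).
by apply/eqP; rewrite eq_sym.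
Qed.
End Rules.

Section LocalIsomorphism.
Variable R : realType.
Implicit Types (p q : plane R) (g t s : motion R) (T X : set (motion R)) (F : pos -> deco).

(** * Local isomorphism *)

Lemma vertex_comp g t k : vertex (comp g t) k = act g (vertex t k).
Proof. by rewrite /vertex act_comp. Qed.

Lemma red_comp g t k : red (comp g t) k = mirror g (+) red t k.
Proof. by rewrite /red addbA. Qed.

Lemma edge_comp g t k : edge (comp g t) k = act g @` edge t k.
Proof. by rewrite /edge !vertex_comp image_setU !image_set1. Qed.

Lemma stripe_comp g t k : stripe_point (comp g t) k = act g (stripe_point t k).
Proof.
rewrite /stripe_point !vertex_comp; move: (vertex t _) (vertex t _) => [a b] [c d].
rewrite /act /mulp /conjp /GRing.scale /= /GRing.scale /=.
by case: (mirror g) => /=; congr (_, _); rewrite /scale_pair /GRing.scale /=; field.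
Qed.

Lemma image_act_inj g (A B : set (plane R)) : act g @` A = act g @` B -> A = B.
Proof.
have sub (C D : set (plane R)) : act g @` C = act g @` D -> C `<=` D.
  move=> e p Cp; have : (act g @` D) (act g p) by rewrite -e; exists p.
  by case=> q Dq /act_inj <-.
by move=> e; apply/seteqP; split; apply: sub.
Qed.

Lemma has_edge_comp g t p q : has_edge (comp g t) (act g p) (act g q) <-> has_edge t p q.
Proof.
have e : [set act g p; act g q] = act g @` [set p; q] by rewrite image_setU !image_set1.
split=> -[k ek]; exists k; last by rewrite edge_comp ek e.
by apply: (@image_act_inj g); rewrite -edge_comp ek e.
Qed.

(** Each matching rule is about three tiles at most, so this weak form of
    embedding transports both of them. *)
Definition includes T' T := forall t1 t2 t3, T' t1 -> T' t2 -> T' t3 ->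
  exists g, [/\ T (comp g t1), T (comp g t2) & T (comp g t3)].

Lemma includes_R1 T' T : includes T' T -> R1 T -> R1 T'.
Proof.
move=> inc r t t' k k' Tt Tt' e; have [g [h h' _]] := inc _ _ _ Tt Tt' Tt.
by apply: (@act_inj _ g); rewrite -!stripe_comp; apply: r; rewrite // !edge_comp e.
Qed.

Lemma includes_R2 T' T : includes T' T -> R2 T -> R2 T'.
Proof.
move=> inc r t tp tq i j Tt Ttp Ttq p q he hp hq; have [g [h hhp hhq]] := inc _ _ _ Tt Ttp Ttq.
have := r _ _ _ i j h hhp hhq; rewrite !vertex_comp !red_comp.
move=> /(_ (iffRL (has_edge_comp _ _ _ _) he)).
move=> /(_ (fun x => hp (iffLR (has_edge_comp _ _ _ _) x))).
move=> /(_ (fun x => hq (iffLR (has_edge_comp _ _ _ _) x))).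
by move=> ne e; apply: ne; rewrite e.
Qed.

Lemma dist_dsq p q : dist p q = Num.sqrt (dsq p q). Proof. by []. Qed.

Definition radius t : R := Num.sqrt (2 + 2 * dsq (shift t) (0, 0)).

Lemma dsq_triangle p q r : dsq p r <= 2 * dsq p q + 2 * dsq q r.
Proof.
have -> : 2 * dsq p q + 2 * dsq q r = dsq p r + ((p.1 + r.1 - 2 * q.1) ^+ 2 + (p.2 + r.2 - 2 * q.2) ^+ 2).
  by rewrite /dsq; ring.
by rewrite lerDl addr_ge0 // sqr_ge0.
Qed.

Lemma body_disk t (r : R) : radius t <= r -> body t `<=` disk (0, 0) r.
Proof.
move=> hr p /body_dsq h; rewrite /disk /= dist_dsq; apply: le_trans hr.
by apply: ler_wsqrtr; have := dsq_triangle p (shift t) (0, 0); lra.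
Qed.

Lemma embeds_includes T' T : embeds T' T -> includes T' T.
Proof.
move=> emb t1 t2 t3 h1 h2 h3.
have r0 t : 0 <= radius t by exact: sqrtr_ge0.
pose P := [set t | t = t1 \/ t = t2 \/ t = t3].
have [||g hg] := emb (radius t1 + radius t2 + radius t3) (0, 0) P.
- by move=> t [->|[->|->]].
- move=> t h; apply: body_disk; have := r0 t1; have := r0 t2; have := r0 t3.
  by case: h => [->|[->|->]]; lra.
by exists g; split; apply: hg; rewrite /P /=; auto.
Qed.

Lemma locally_isomorphic_legal T T' : legal T -> tiling T' -> locally_isomorphic T T' -> legal T'.
Proof.
move=> [_ r1 r2] tT' [_ /embeds_includes inc].
by split => //; [exact: includes_R1 inc r1 | exact: includes_R2 inc r2].
Qed.

(** A legal tiling, seen in the frame of one of its tiles: the decoration at 0 is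
    then that of the prototile. *)
Lemma legal_field T t0 : legal T -> T t0 ->
  exists F, [/\ F 0 = proto_deco, T = moved t0 (@field_of R F) & legal_deco F].
Proof.
move=> [tT r1 r2] Tt0.
have cT : covers T by case: tT.
have [F [F0 eT]] := tiling_field (tiling_apart tT) cT Tt0.
exists F; split => //.
have inc : includes (@field_of R F) T.
  by move=> t1 t2 t3 h1 h2 h3; exists t0; rewrite eT; split; apply: imageP.
move=> y i; split; first exact: R1_edge_ok (includes_R1 inc r1).
exact: R2_diam_ok (includes_R2 inc r2).
Qed.

Lemma field_legal F : legal_deco F -> legal (@field_of R F).
Proof. by move=> lF; split; [exact: field_tiling | exact: legal_deco_R1 | exact: legal_deco_R2]. Qed.

(** The tile [t] has a vertex where the half-diameters of three tiles have the same
    colour.  This is invariant under motions, as reflections swap both colours. *)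
Definition exc_tile T t := exists t2 t3 k1 k2 k3,
  [/\ T t, T t2, T t3 & [/\ t <> t2, t <> t3 & t2 <> t3]] /\
  [/\ vertex t k1 = vertex t2 k2, vertex t k1 = vertex t3 k3,
      red t k1 = red t2 k2 & red t k1 = red t3 k3].

Lemma exc_tile_comp T T' g t : exc_tile T t ->
  (forall s, T s -> T' (comp g s)) -> exc_tile T' (comp g t).
Proof.
move=> [t2 [t3 [k1 [k2 [k3 [[h1 h2 h3 [n1 n2 n3]] [e1 e2 e3 e4]]]]]]] h.
exists (comp g t2), (comp g t3), k1, k2, k3; split.
  by split; [exact: h | exact: h | exact: h | split=> /comp_inj].
by split; rewrite ?vertex_comp ?red_comp ?e1 ?e2 ?e3 ?e4 // -?e2 -?e1 -?e3 -?e4.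
Qed.

Lemma exc_tile_includes T T' t : exc_tile T t -> includes T T' -> exists t', exc_tile T' t'.
Proof.
move=> [t2 [t3 [k1 [k2 [k3 [[h1 h2 h3 [n1 n2 n3]] [e1 e2 e3 e4]]]]]]] inc.
have [g [g1 g2 g3]] := inc _ _ _ h1 h2 h3.
exists (comp g t), (comp g t2), (comp g t3), k1, k2, k3; split.
  by split => //; split=> /comp_inj.
by rewrite !vertex_comp !red_comp -e1 -e2 -e3 -e4.
Qed.

Lemma vertex_index y D i : exists k, vdir D (dirz k) = i /\
  vertex (std R y D) k = mpt R (site y + dv i).
Proof.
exists (zdir (if D.2 then subd D.1 i else subd i D.1)); rewrite vertex_std zdirK.
suff e : vdir D (if D.2 then subd D.1 i else subd i D.1) = i by rewrite e.
by case: D => [[] []]; case: i.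
Qed.

Lemma exc_field F y : exc (cluster F y) -> exc_tile (@field_of R F) (std R y (F y)).
Proof.
move=> /hasP [i _]; rewrite ctr_cluster !armE => /andP [/eqP r1 /eqP r2].
have [k1 [d1 v1]] := vertex_index y (F y) i.
have [k2 [d2 v2]] := vertex_index (y + dv i) (F (y + dv i)) (addd H4 i).
have [k3 [d3 v3]] := vertex_index (y + dv (pv i)) (F (y + dv (pv i))) (addd H2 i).
exists (std R (y + dv i) (F (y + dv i))), (std R (y + dv (pv i)) (F (y + dv (pv i)))), k1, k2, k3.
split; last first.
  rewrite !red_std d1 d2 d3 v1 v2 v3; split => //; congr (mpt R _); rewrite siteD site_dv.
    by case: (i) => /=; plia.
  by case: (i) => /=; plia.
split; [by exists y | by exists (y + dv i) | by exists (y + dv (pv i)) |].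
have ny j : y <> y + dv j by rewrite -{1}[y]addr0 => /addrI; case: j.
split=> /std_inj [e _]; [exact: ny e | exact: ny e |].
by move/addrI: e; case: (i).
Qed.

Lemma field_exc F y : exc_tile (@field_of R F) (std R y (F y)) -> exc (cluster F y).
Proof.
move=> [_ [_ [k1 [k2 [k3 [[_ [y2 ->] [y3 ->] [n1 n2 n3]] []]]]]]].
rewrite !vertex_std !red_std.
move: (vdir _ (dirz k1)) (vdir _ (dirz k2)) (vdir _ (dirz k3)) => i j l.
move=> /mpt_inj e2 /mpt_inj e3 r2 r3.
have ny2 : y2 <> y by move=> e; apply: n1; rewrite e.
have ny3 : y3 <> y by move=> e; apply: n2; rewrite e.
have n23 : y2 <> y3 by move=> e; apply: n3; rewrite e.
apply/hasP; exists i; first exact: mem_dirs.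
rewrite ctr_cluster !armE.
have e4 : addd H4 i = nx (nx (nx (nx i))) by [].
have e5 : addd H2 i = nx (nx i) by [].
rewrite e4 e5.
case: (vertex_at e2) => [//|[h2 j2]|[h2 j2]]; case: (vertex_at e3) => [//|[h3 j3]|[h3 j3]].
- by case: n23; rewrite h2 h3.
- by rewrite -h2 -h3 -j2 -j3 r2 -r3 r2 !eqxx.
- by rewrite -h2 -h3 -j3 -j2 -r2 -r3 !eqxx.
by case: n23; rewrite h2 h3.
Qed.

(** A patch in a disk is carried by finitely many sites, within some hexagonal
    ball, and recurs in [F'] up to a translation of the lattice. *)
Lemma field_embeds g g' F F' : legal_deco F -> nonexc F -> legal_deco F' ->
  embeds (moved g (@field_of R F)) (moved g' (@field_of R F')).
Proof.
move=> lF neF lF' r x P PT Pd.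
have [a [b ex]] := pt_surj (undo g x).
have bound y : P (comp g (std R y (F y))) ->
    0 <= r /\ sqn ((site y).1%:~R - a) ((site y).2%:~R - b) <= r ^+ 2.
  move=> hP; have : body (comp g (std R y (F y))) (act g (mpt R (site y))).
    apply/body_comp; apply: dsq_body; rewrite /= dsqxx; lra.
  move=> /(Pd _ hP); rewrite /disk /= dist_dsq => h.
  have r0 : 0 <= r by apply: le_trans h; apply: sqrtr_ge0.
  split => //; rewrite -dsqE -ex -(dsq_act g) actK.
  by rewrite -ler_sqrt ?sqrtr_sqr ?ger0_norm // sqr_ge0.
have [N hN] : exists N : nat, forall y, P (comp g (std R y (F y))) -> hex N%:Z y.
  have [N hN] : exists N : nat, `|a| + `|b| + 4 * `|r| < N%:R.
    by exists (Num.truncn (`|a| + `|b| + 4 * `|r|)).+1; apply: truncnS_gt.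
  exists N => y /bound [r0]; move: hN; rewrite (ger0_norm r0) => hN.
  rewrite /sqn; set m := (site y).1; set n := (site y).2.
  set u := m%:~R - a; set v := n%:~R - b => hq.
  have sq (c : R) : c * c <= 4 / 3 * r ^+ 2 -> - (2 * r) <= c <= 2 * r.
    by rewrite expr2 => hc; apply/andP; split; nra.
  have hu : - (2 * r) <= u <= 2 * r.
    by apply: sq; have := sqr_ge0 (v + u / 2); rewrite expr2; lra.
  have hv : - (2 * r) <= v <= 2 * r.
    by apply: sq; have := sqr_ge0 (u + v / 2); rewrite expr2; lra.
  have ha := ler_norm a; have hb := ler_norm b.
  have ha' := ler_norm (- a); have hb' := ler_norm (- b); rewrite !normrN in ha' hb'.
  move: hu hv => /andP [u1 u2] /andP [v1 v2].
  have em : m%:~R = u + a by rewrite /u; ring.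
  have en : n%:~R = v + b by rewrite /v; ring.
  have lt (c : int) : (c%:~R : R) < N%:R -> c < N%:Z by rewrite -[N%:R]/(N%:Z%:~R) ltr_int.
  have k1 : m + n < N%:Z by apply: lt; rewrite intrD em en; lra.
  have k2 : - m - n < N%:Z by apply: lt; rewrite intrB mulrNz em en; lra.
  have k3 : m - n < N%:Z by apply: lt; rewrite intrB em en; lra.
  have k4 : n - m < N%:Z by apply: lt; rewrite intrB em en; lra.
  have k5 : m < N%:Z by apply: lt; rewrite em; lra.
  have k6 : - m < N%:Z by apply: lt; rewrite mulrNz em; lra.
  have k7 : n < N%:Z by apply: lt; rewrite en; lra.
  have k8 : - n < N%:Z by apply: lt; rewrite mulrNz en; lra.
  move: k1 k2 k3 k4 k5 k6 k7 k8; rewrite /m /n /site; clear; rewrite /hex /=; lia.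
have [z hz] := nonexc_repetitive N lF neF lF'.
have [h hh] := inverse_motion g.
exists (comp g' (comp (std R z proto_deco) h)) => t Pt.
have [_ [y ->] et] := PT t Pt; rewrite -et in Pt *.
rewrite compA compA hh comp_std_translate; apply: imageP; exists (z + y).
by rewrite (hz y (hN y Pt)) addrC.
Qed.

Lemma embeds_moved g X : embeds X (moved g X).
Proof. by move=> r x P PX _; exists g => t /PX; apply: imageP. Qed.

Lemma moved_embeds g X : embeds (moved g X) X.
Proof.
move=> r x P PX _; have [h hh] := inverse_motion g.
by exists h => t /PX [s Xs <-]; rewrite hh.
Qed.

Lemma moved_id X : moved (idm R) X = X.
Proof.
by apply/seteqP; split=> [_ [t Xt <-]|t Xt]; [rewrite comp1 | exists t; rewrite ?comp1].
Qed.

(** If some tile of [T] has an exceptional vertex, then in the frame of that tile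
    the decoration is [singular]; else the decoration is unexceptional. *)
Lemma legal_classification T : legal T ->
  locally_isomorphic (@field_of R regular) T \/ locally_isomorphic (@field_of R singular) T.
Proof.
move=> lT.
have [[t et]|ne] := pselect (exists t, exc_tile T t).
  have Tt : T t by case: et => t2 [t3 [k1 [k2 [k3 [[]]]]]].
  have [F [F0 eT lF]] := legal_field lT Tt.
  have e : exc (cluster F 0).
    apply: field_exc; rewrite F0 std_id; have [h hh] := inverse_motion t.
    have -> : idm R = comp h t by rewrite -{1}(comp_id t) hh.
    by apply: exc_tile_comp et _ => s; rewrite {1}eT => -[s' Fs' <-]; rewrite hh.
  have eF : F = singular.
    apply: funext.
    exact: exc_unique lF singular_legal e singular_exc (etrans F0 (esym singular0)).
  right; rewrite eT eF; split; [exact: embeds_moved | exact: moved_embeds].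
have [t Tt _] : exists2 t, T t & body t (0, 0) by case: lT => -[c _] _ _; apply: c.
have [F [F0 eT lF]] := legal_field lT Tt.
have neF : nonexc F.
  move=> y; apply/negP => /exc_field ey; apply: ne.
  exists (comp t (std R y (F y))); rewrite eT; apply: exc_tile_comp ey _ => s; exact: imageP.
left; rewrite eT -[field_of regular]moved_id; split.
  exact: field_embeds regular_legal regular_nonexc lF.
exact: field_embeds lF neF regular_legal.
Qed.

(** The three tiles around the exceptional vertex of the second tiling do not occur
    in the first one. *)
Lemma regular_not_singular :
  ~ locally_isomorphic (@field_of R regular) (@field_of R singular).
Proof.
move=> [_ /embeds_includes inc].
have [t et] := exc_tile_includes (exc_field singular_exc) inc.
have [y e] : field_of regular t by case: et => t2 [t3 [k1 [k2 [k3 [[]]]]]].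
by have := regular_nonexc y; rewrite field_exc // -e.
Qed.

End LocalIsomorphism.

Theorem mainTheorem2 (R : realType) :
  exists T1 T2 : set (tile R),
    [/\ tiling T1, tiling T2, LI_class T1 <> LI_class T2
      & @legal R = LI_class T1 `|` LI_class T2].
Proof.
have lT1 := field_legal R regular_legal; have lT2 := field_legal R singular_legal.
exists (@field_of R regular), (@field_of R singular).
split; [exact: field_tiling | exact: field_tiling | |].
  move=> e; apply: (@regular_not_singular R).
  have : LI_class (@field_of R singular) (@field_of R singular).
    split; first exact: field_tiling.
    by split; rewrite -{2}[field_of singular]moved_id; exact: embeds_moved.
  by rewrite -e => -[].
apply/seteqP; split=> T.
  by move=> lT; have [tT _ _] := lT; case: (legal_classification lT) => h; [left | right].
case=> -[tT h]; first exact: locally_isomorphic_legal lT1 tT h.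
exact: locally_isomorphic_legal lT2 tT h.
Qed.
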